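(* One has $$\widehat{\mathcal{H}}_\mu=\left\{f(z)=c+\sum_{x_n\in\operatorname{Sp}(A_\infty)}\frac{c_n}{z-x_n}\;:\; c,c_n\in\mathbb{C},\ \sum_{x_n\in\operatorname{Sp}(A_\infty)}|c_n|^2F'(x_n)<\infty\right\},$$ where the series $\sum_{x_n\in\operatorname{Sp}(A_\infty)} c_n/(z-x_n)$ converge uniformly on compact subsets of $\mathbb{C}\setminus\operatorname{Sp}(A_\infty)$.
   Context: Let $\mathcal{H}$ be a separable Hilbert space with inner product $\langle\cdot,\cdot\rangle$ anti-linear in the first argument. Let $A$ be a (possibly unbounded) self-adjoint operator in $\mathcal{H}$ with discrete spectrum of multiplicity one (its spectrum consists only of isolated eigenvalues, each of multiplicity one). Let $\mu\in\mathcal{H}$ be a cyclic vector for $A$ (i.e. $\{(A-zI)^{-1}\mu : z\in\mathbb{C}\setminus\operatorname{Sp}(A)\}$ is a total set in $\mathcal{H}$) with $\|\mu\|=1$. $\operatorname{Sp}(\cdot)$ denotes the spectrum. Let $F(z):=\langle\mu,(A-zI)^{-1}\mu\rangle$ for $z\notin\operatorname{Sp}(A)$; this is a meromorphic function on $\mathbb{C}$. $A_\infty$ denotes the infinite-coupling member ($h=\infty$) of the family $A_h:=A+h\langle\mu,\cdot\rangle\mu$ of rank-one perturbations of $A$; its spectrum is $\operatorname{Sp}(A_\infty)=\{x\in\mathbb{R}:F(x)=0\}$. Define $\xi(z):=\dfrac{(A-\overline{z}I)^{-1}\mu}{F(\overline{z})}$ for $z\in\mathbb{C}\setminus\operatorname{Sp}(A_\infty)$,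 where at points of $\operatorname{Sp}(A)$ (poles of $F$) the value is understood as the limit. For $\varphi\in\mathcal{H}$ define $(\Phi_\mu\varphi)(z):=\langle\xi(z),\varphi\rangle$, $z\in\mathbb{C}\setminus\operatorname{Sp}(A_\infty)$, and $\widehat{\mathcal{H}}_\mu:=\Phi_\mu\mathcal{H}$, a linear space of functions on $\mathbb{C}\setminus\operatorname{Sp}(A_\infty)$. *)

(* Defs.v *)
From HB Require Import structures.
From mathcomp Require Import all_boot all_order all_algebra finmap.
From mathcomp Require Import sesquilinear complex.
From mathcomp Require Import all_classical all_reals all_analysis.
From mathcomp Require analysis.showcase.summability.

Set Implicit Arguments.
Unset Strict Implicit.
Unset Printing Implicit Defensive.

Import Order.TTheory GRing.Theory Num.Theory.
Import numFieldNormedType.Exports.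

Local Open Scope classical_set_scope.
Local Open Scope ring_scope.

(* MathComp-Analysis puts the norm topology on the carrier of any
   numClosedFieldType, but not on the bare type R[i]; hence this packaging. *)
Definition CC (R : realType) : numClosedFieldType := R[i].

Section LinearRelations.
Context {R : realType} {H : completeNormedModType (CC R)}.
Variable ip : {dot H for @Num.conj (CC R)}.

(* MathComp's sesquilinear forms are linear in the first argument. *)
Definition inner (x y : H) : CC R := ip y x.

(* [H] with [ip] is a Hilbert space: it is complete for the norm of [ip]. *)
Definition hilbert : Prop := forall x : H, inner x x = `|x| ^+ 2.

Definition separable : Prop := exists2 S : set H, countable S & dense S.

Definition total (X : set H) : Prop :=
  dense [set v | exists (n : nat) (a : 'I_n -> CC R) (x : 'I_n -> H),
                   (forall i, X (x i)) /\ v = \sum_(i < n) a i *: x i].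

(* A possibly unbounded operator T is given by its graph
   {(x, T x) | x in the domain of T}; a set of pairs which is not single-valued
   is a linear relation, i.e. a multivalued operator. *)
Implicit Type T : set (H * H).

Definition linear_relation T : Prop :=
  T (0, 0) /\ forall (a : CC R) p q, T p -> T q -> T (a *: p + q).

Definition single_valued T : Prop :=
  forall x y y', T (x, y) -> T (x, y') -> y = y'.

Definition adjoint T : set (H * H) :=
  [set p | forall x y, T (x, y) -> inner p.1 y = inner p.2 x].

Definition self_adjoint_operator T : Prop :=
  [/\ linear_relation T, single_valued T, dense (fst @` T) & adjoint T = T].

(* T (f, g + z *: f) reads "f is in the domain of T and (T - z) f = g"; so z is
   in the resolvent set iff (T - z)^-1 is an everywhere defined bounded
   operator. *)
Definition resolvent_set T : set (CC R) :=
  [set z | (forall g, exists! f, T (f, g + z *: f)) /\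
           exists M : CC R,
             forall f g, T (f, g + z *: f) -> `|f| <= M * `|g| ].

Definition spectrum T : set (CC R) := ~` resolvent_set T.

(* (T - z)^-1 g, for z in the resolvent set *)
Definition resolvent T (z : CC R) (g : H) : H :=
  get [set f | T (f, g + z *: f)].

Definition eigenspace T (z : CC R) : set H := [set f | T (f, z *: f)].

Definition simple_eigenvalue T (z : CC R) : Prop :=
  exists2 e : H, e != 0 & eigenspace T z = [set a *: e | a in [set: CC R]].

Definition simple_discrete_spectrum T : Prop :=
  forall z, spectrum T z -> isolated (spectrum T) z /\ simple_eigenvalue T z.

End LinearRelations.

Arguments separable {R} H.

Section RankOnePerturbations.
Context {R : realType} {H : completeNormedModType (CC R)}.
Variables (ip : {dot H for @Num.conj (CC R)}) (A : set (H * H)) (mu : H).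

Definition cyclic_vector : Prop :=
  total [set resolvent A z mu | z in ~` spectrum A].

Definition borel_transform (z : CC R) : CC R := inner ip mu (resolvent A z mu).

(* The graph of A + h <mu, .> mu is the set of all (f, g + c *: mu) with (f, g)
   in the graph of A and h^-1 * c = <mu, f>; at h = oo the latter equation is
   <mu, f> = 0, c being free.  As <mu, .> is bounded, the result is not an
   operator but a self-adjoint relation, with multivalued part spanned by mu; its
   operator part is the compression of A to the orthogonal complement of mu, and
   has the same spectrum. *)
Definition infinite_coupling : set (H * H) :=
  [set p | inner ip mu p.1 = 0 /\ exists c : CC R, A (p.1, p.2 - c *: mu)].

Let Sp_oo : set (CC R) := spectrum infinite_coupling.

Definition xi_regular (z : CC R) : H :=
  (borel_transform (Num.conj z))^-1 *: resolvent A (Num.conj z) mu.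

Definition xi (z : CC R) : H :=
  if z \in spectrum A then lim (xi_regular w @[w --> z^']) else xi_regular z.

(* Functions on the complement of Sp_oo are functions on the corresponding
   subtype, which carries the subspace topology. *)
Definition Phi (phi : H) : ~` Sp_oo -> CC R :=
  fun z => inner ip (xi (\val z)) phi.

Definition Hhat : set (~` Sp_oo -> CC R) := range Phi.

(* Families (c_n) are indexed by the points x_n of Sp_oo themselves.  The
   spectrum is real and F' is positive at the zeros of F, so Re only serves to
   change types. *)
Definition weighted_square_summable (a : Sp_oo -> CC R) : Prop :=
  (\esum_(x in [set: Sp_oo])
     (complex.Re (`|a x| ^+ 2 * derive1 borel_transform (\val x)))%:E < +oo)%E.

(* Sums over Sp_oo (finite or countable) are limits along the directed set of its
   finite subsets. *)
Definition partial_fractions (a : Sp_oo -> CC R) (B : {fset Sp_oo}) :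
    ~` Sp_oo -> CC R :=
  fun z => summability.partial_sum (fun x => a x / (\val z - \val x)) B.

Definition partial_fraction_series (a : Sp_oo -> CC R) : ~` Sp_oo -> CC R :=
  fun z => summability.sum (fun x => a x / (\val z - \val x)).

End RankOnePerturbations.

Arguments Hhat {R H} ip A mu.

(* Main.v *)
Require Import Defs.
From HB Require Import structures.
From mathcomp Require Import all_boot all_order all_algebra finmap.
From mathcomp Require Import sesquilinear complex.
From mathcomp Require Import all_classical all_reals all_analysis.
From mathcomp Require analysis.showcase.summability.
From mathcomp Require Import ring lra.

(* Write R(z) for the resolvent of A and A_oo for the relation at infinite
   coupling.  For x in Sp(A_oo), i.e. F(x) = 0, the vector eta_x = R(x) mu is an
   eigenvector of A_oo; these vectors are orthogonal to mu and to each other,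
   |eta_x|^2 = F'(x), <xi(z), mu> = 1 and <xi(z), eta_x> = 1 / (z - x).  Hence
   phi = c mu + sum_x c_x eta_x is mapped to c + sum_x c_x / (z - x), and the
   series converges locally uniformly because xi is locally bounded.

   That mu and the eta_x span H is the completeness of the eigenvectors of the
   self-adjoint relation A_oo, whose multivalued part is spanned by mu.  It
   follows without a spectral theorem: a bounded symmetric B vanishes on an
   invariant subspace S as soon as B - s is bounded below on S for all real
   s <> 0.  Take for B a resolvent of A_oo and for S the orthogonal complement
   of all eigenvectors; what is needed is that T - lam is bounded below on the
   complement of its kernel when lam is isolated in the spectrum of T. *)

Set Implicit Arguments.
Unset Strict Implicit.
Unset Printing Implicit Defensive.

Import Order.TTheory GRing.Theory Num.Theory.
Import numFieldNormedType.Exports.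
Local Open Scope classical_set_scope.
Local Open Scope ring_scope.

(** * Real-valued moduli and norms *)

Section ComplexScalars.
Context {R : realType}.
Implicit Types (t : R) (a b : CC R).

Definition rc t : CC R := real_complex R t.

(** The norm of [CC R] takes values in [CC R] itself, which is only partially ordered. Real-valued
    moduli, and [nrm] below, bring estimates within reach of [lra] and [nra]. *)
Definition modulus a : R := complex.Re `|a|.

Lemma ge0_rcE a : 0 <= a -> a = rc (complex.Re a).
Proof. by move=> a0; rewrite /rc (RRe_real (ger0_real a0)). Qed.

Lemma modulusE a : `|a| = rc (modulus a).
Proof. exact: ge0_rcE. Qed.

Lemma rc_inj : injective rc.
Proof. by move=> x y []. Qed.

Lemma rcD t t' : rc (t + t') = rc t + rc t'.
Proof. exact: (rmorphD (real_complex R)). Qed.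

Lemma rcN t : rc (- t) = - rc t.
Proof. exact: (rmorphN (real_complex R)). Qed.

Lemma rcM t t' : rc (t * t') = rc t * rc t'.
Proof. exact: (rmorphM (real_complex R)). Qed.

Lemma rcX t n : rc (t ^+ n) = rc t ^+ n.
Proof. exact: (rmorphXn (real_complex R)). Qed.

Lemma rcV t : rc t^-1 = (rc t)^-1.
Proof. exact: (fmorphV (real_complex R)). Qed.

Lemma rc0 : rc 0 = 0. Proof. by []. Qed.

Lemma rc1 : rc 1 = 1. Proof. by []. Qed.

Lemma ler_rc t t' : (rc t <= rc t') = (t <= t').
Proof. exact: lecR. Qed.

Lemma ltr_rc t t' : (rc t < rc t') = (t < t').
Proof. exact: ltcR. Qed.

Lemma conj_rc t : Num.conj (rc t) = rc t.
Proof. by apply: conj_Creal; apply/complex_realP; exists t. Qed.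

Lemma conjM a b : Num.conj (a * b) = Num.conj a * Num.conj b.
Proof. exact: rmorphM. Qed.

Lemma conj_fix_real a : Num.conj a = a -> a = rc (complex.Re a).
Proof. by move/CrealP => ra; rewrite /rc (RRe_real ra). Qed.

Lemma Re_rc t : complex.Re (rc t) = t.
Proof. by []. Qed.

Lemma ReD a b : complex.Re (a + b) = complex.Re a + complex.Re b.
Proof. by case: a b => [? ?] []. Qed.

Lemma ReN a : complex.Re (- a) = - complex.Re a.
Proof. by case: a. Qed.

Lemma ReZ t a : complex.Re (rc t * a) = t * complex.Re a.
Proof. by case: a => x y /=; rewrite mul0r subr0. Qed.

Lemma modulus_ge0 a : 0 <= modulus a.
Proof. by rewrite -ler_rc -modulusE rc0. Qed.

Lemma modulus0 : modulus 0 = 0.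
Proof. by apply: rc_inj; rewrite -modulusE normr0. Qed.

Lemma modulus_eq0 a : (modulus a == 0) = (a == 0).
Proof. by rewrite -[RHS]normr_eq0 modulusE -(inj_eq rc_inj). Qed.

Lemma modulus_gt0 a : (0 < modulus a) = (a != 0).
Proof. by rewrite lt_neqAle eq_sym modulus_eq0 modulus_ge0 andbT. Qed.

Lemma modulusM a b : modulus (a * b) = modulus a * modulus b.
Proof. by apply: rc_inj; rewrite rcM -!modulusE normrM. Qed.

Lemma modulusV a : modulus a^-1 = (modulus a)^-1.
Proof. by apply: rc_inj; rewrite rcV -!modulusE normfV. Qed.

Lemma modulusN a : modulus (- a) = modulus a.
Proof. by rewrite /modulus normrN. Qed.

Lemma modulus_conj a : modulus (Num.conj a) = modulus a.
Proof. by rewrite /modulus norm_conjC. Qed.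

Lemma modulus_rc t : modulus (rc t) = `|t|.
Proof.
rewrite /modulus; have [t0|t0] := leP 0 t.
  by rewrite ger0_norm ?ler_rc // ger0_norm.
by rewrite ltr0_norm ?ltr_rc // ltr0_norm // -rcN.
Qed.

Lemma modulusD a b : modulus (a + b) <= modulus a + modulus b.
Proof. by rewrite -ler_rc rcD -!modulusE ler_normD. Qed.

Lemma mulconj a : Num.conj a * a = rc (modulus a ^+ 2).
Proof. by rewrite rcX -modulusE normCKC. Qed.

Lemma nbhs_CC (z : CC R) (P : set (CC R)) :
  nbhs z P <-> exists2 e : R, 0 < e & forall w, modulus (w - z) < e -> P w.
Proof.
split=> [/nbhs_ballP[e /= e0 zP]|[e e0 zP]].
  exists (complex.Re e); first by rewrite -ltr_rc rc0 -ge0_rcE // ltW.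
  move=> w; rewrite -ltr_rc -modulusE -ge0_rcE; last exact: ltW.
  by move=> we; apply: zP; rewrite -ball_normE /= distrC.
apply/nbhs_ballP; exists (rc e) => /=; first by rewrite ltr_rc.
move=> w; rewrite -ball_normE /= distrC modulusE ltr_rc; exact: zP.
Qed.

End ComplexScalars.

Section RealNorm.
Context {R : realType} {H : completeNormedModType (CC R)}.
Implicit Types x y v : H.

Definition nrm x : R := complex.Re `|x|.

Lemma nrmE x : `|x| = rc (nrm x).
Proof. exact: ge0_rcE. Qed.

Lemma nrm_ge0 x : 0 <= nrm x.
Proof. by rewrite -ler_rc -nrmE rc0. Qed.

Lemma nrm0 : nrm 0 = 0.
Proof. by apply: rc_inj; rewrite -nrmE normr0. Qed.

Lemma nrm_eq0 x : (nrm x == 0) = (x == 0).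
Proof. by rewrite -[RHS]normr_eq0 nrmE -(inj_eq rc_inj). Qed.

Lemma nrm_gt0 x : (0 < nrm x) = (x != 0).
Proof. by rewrite lt_neqAle eq_sym nrm_eq0 nrm_ge0 andbT. Qed.

Lemma nrmZ (a : CC R) x : nrm (a *: x) = modulus a * nrm x.
Proof. by apply: rc_inj; rewrite rcM -nrmE -modulusE -nrmE normrZ. Qed.

Lemma nrmN x : nrm (- x) = nrm x.
Proof. by rewrite /nrm normrN. Qed.

Lemma nrmD x y : nrm (x + y) <= nrm x + nrm y.
Proof. by rewrite -ler_rc rcD -!nrmE ler_normD. Qed.

Lemma nrmB x y : nrm (x - y) <= nrm x + nrm y.
Proof. by rewrite -(nrmN y) nrmD. Qed.

Lemma nrm_distC x y : nrm (x - y) = nrm (y - x).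
Proof. by rewrite -nrmN opprB. Qed.

Lemma nbhs_H x (P : set H) :
  nbhs x P <-> exists2 e : R, 0 < e & forall y, nrm (y - x) < e -> P y.
Proof.
split=> [/nbhs_ballP[e /= e0 xP]|[e e0 xP]].
  exists (complex.Re e); first by rewrite -ltr_rc rc0 -ge0_rcE // ltW.
  move=> w; rewrite -ltr_rc -nrmE -ge0_rcE; last exact: ltW.
  by move=> we; apply: xP; rewrite -ball_normE /= distrC.
apply/nbhs_ballP; exists (rc e) => /=; first by rewrite ltr_rc.
move=> w; rewrite -ball_normE /= distrC nrmE ltr_rc; exact: xP.
Qed.

Lemma nrm_small0 x : (forall e, 0 < e -> nrm x <= e) -> x = 0.
Proof.
move=> xe; apply/eqP; rewrite -nrm_eq0 eq_le nrm_ge0 andbT.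
by apply/ler_addgt0Pr => e e0; rewrite add0r xe.
Qed.

End RealNorm.

(** * Inner product identities and the Cauchy-Schwarz inequality *)

Section InnerProduct.
Context {R : realType} {H : completeNormedModType (CC R)}.
Variable ip : {dot H for @Num.conj (CC R)}.
Hypothesis hilbertH : hilbert ip.
Implicit Types (x y v : H) (a : CC R).
Local Notation "<< x , y >>" := (inner ip x y).

Lemma inDr x y v : << x, y + v >> = << x, y >> + << x, v >>.
Proof. exact: linearDl. Qed.

Lemma inDl x y v : << x + y, v >> = << x, v >> + << y, v >>.
Proof. exact: linearDr. Qed.

Lemma inNr x y : << x, - y >> = - << x, y >>.
Proof. exact: linearNl. Qed.

Lemma inNl x y : << - x, y >> = - << x, y >>.
Proof. exact: linearNr. Qed.

Lemma in0r x : << x, 0 >> = 0.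
Proof. exact: linear0l. Qed.

Lemma in0l x : << 0, x >> = 0.
Proof. exact: linear0r. Qed.

Lemma inZr a x y : << x, a *: y >> = a * << x, y >>.
Proof. exact: linearZl_LR. Qed.

Lemma inZl a x y : << a *: x, y >> = Num.conj a * << x, y >>.
Proof. exact: linearZr_LR. Qed.

Definition ipE := (inDr, inDl, inNr, inNl, in0r, in0l, inZr, inZl).

Lemma inC x y : << y, x >> = Num.conj << x, y >>.
Proof. by rewrite /inner hermC expr0 mul1r. Qed.

Lemma in_self x : << x, x >> = rc (nrm x ^+ 2).
Proof. by rewrite hilbertH nrmE rcX. Qed.

(** Turns vector identities into scalar ones, which [ring] and [field] decide; the tactic [vec]
    rests on it. *)
Lemma in_ext x y : (forall v, << v, x >> = << v, y >>) -> x = y.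
Proof.
move=> xy; apply/eqP; rewrite -subr_eq0 -nrm_eq0 -sqrf_eq0 -(inj_eq rc_inj).
by rewrite -in_self inDr inNr xy subrr.
Qed.

Lemma in_suml I (r : seq I) (P : pred I) (F : I -> H) y :
  << \sum_(i <- r | P i) F i, y >> = \sum_(i <- r | P i) << F i, y >>.
Proof. exact: linear_sumr. Qed.

Lemma in_sumr I (r : seq I) (P : pred I) (F : I -> H) x :
  << x, \sum_(i <- r | P i) F i >> = \sum_(i <- r | P i) << x, F i >>.
Proof. exact: linear_sumlz. Qed.

Lemma nrm_sqrD x y :
  nrm (x + y) ^+ 2 = nrm x ^+ 2 + 2 * complex.Re << x, y >> + nrm y ^+ 2.
Proof.
apply: rc_inj; rewrite -in_self !ipE !in_self (inC x y) !rcD (rcM 2).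
have -> : rc (complex.Re << x, y >>) = (<< x, y >> + Num.conj << x, y >>) / 2%:R.
  exact: (ReJ_add (<< x, y >>)).
have -> : rc 2 = 2%:R :> CC R by rewrite -[2]/(1 + 1) rcD rc1.
by field.
Qed.

Lemma CauchySchwarz x y : modulus << x, y >> <= nrm x * nrm y.
Proof.
have [->|x0] := eqVneq x 0; first by rewrite in0l modulus0 nrm0 mul0r.
have n0 : 0 < nrm x by rewrite nrm_gt0.
set a := << x, y >>.
(* This vector is |x|^2 times the component of y orthogonal to x; its squared norm is |x|^2 (|x|^2
   |y|^2 - |a|^2). *)
have : 0 <= nrm (rc (nrm x ^+ 2) *: y + (- a) *: x) ^+ 2 by exact: sqr_ge0.
rewrite nrm_sqrD !nrmZ modulus_rc modulusN inZl inZr conj_rc (inC x y) -/a.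
have -> : rc (nrm x ^+ 2) * (- a * Num.conj a)
   = rc (- (nrm x ^+ 2 * modulus a ^+ 2)).
  by rewrite rcN rcM -mulconj; ring.
rewrite Re_rc ger0_norm ?sqr_ge0 // => h.
have : 0 <= nrm x ^+ 2 * ((nrm x * nrm y) ^+ 2 - modulus a ^+ 2) by nra.
rewrite pmulr_rge0 ?exprn_gt0 // subr_ge0.
by rewrite ler_sqr ?nnegrE ?modulus_ge0 // mulr_ge0 ?nrm_ge0.
Qed.

(** Serves as continuity of the inner product: an orthogonality relation passes to a limit when [v]
    is the limit minus an approximant. *)
Lemma in_small_eq0 a x y : (forall e, 0 < e ->
  exists2 v, nrm v <= e & a = << x, v >> + << v, y >>) -> a = 0.
Proof.
move=> h; apply/eqP; rewrite -modulus_eq0 eq_le modulus_ge0 andbT.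
apply/ler_addgt0Pr => e e0; rewrite add0r.
have c0 : 0 < nrm x + nrm y + 1 by rewrite ltr_wpDl // addr_ge0 // nrm_ge0.
have [|v ve ->] := h (e / (nrm x + nrm y + 1)); first by rewrite divr_gt0.
rewrite (le_trans (modulusD _ _)) //.
rewrite (le_trans (lerD (CauchySchwarz _ _) (CauchySchwarz _ _))) //.
rewrite ler_pdivlMr // in ve.
have := nrm_ge0 x; have := nrm_ge0 y; have := nrm_ge0 v; nra.
Qed.

End InnerProduct.

(** * Symmetric linear relations and their resolvents *)

Section Relations.
Context {R : realType} {H : completeNormedModType (CC R)}.
Variable ip : {dot H for @Num.conj (CC R)}.
Hypothesis hilbertH : hilbert ip.
Local Notation "<< x , y >>" := (inner ip x y).
Implicit Types (T : set (H * H)) (z w : CC R) (f g h : H).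

Ltac vec := apply: (in_ext hilbertH) => ?; rewrite !ipE; ring.

Definition symmetric_relation T : Prop :=
  forall f g f' g', T (f, g) -> T (f', g') -> << f, g' >> = << g, f' >>.

(** Stands in for self-adjointness: with symmetry it makes the spectrum real, and it lets a lower
    bound for T - z alone put z in the resolvent set. *)
Definition pure_point_spectrum T : Prop :=
  forall z, spectrum T z -> exists2 f, f != 0 & T (f, z *: f).

Definition bounded_at T z (M : R) : Prop :=
  forall f g, T (f, g + z *: f) -> nrm f <= M * nrm g.

Section Linear.
Variable T : set (H * H).
Hypothesis linT : linear_relation T.

Lemma rel_comb (a b : CC R) f g f' g' : T (f, g) -> T (f', g') ->
  T (a *: f + b *: f', a *: g + b *: g').
Proof.
case: linT => T0 TD fg fg'.
have := TD b _ _ fg' T0; rewrite addr0.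
have e x y : b *: (x, y) = (b *: x, b *: y) by [].
by rewrite e => /(TD a _ _ fg).
Qed.

Lemma relZ (a : CC R) f g : T (f, g) -> T (a *: f, a *: g).
Proof. by move=> fg; have := rel_comb a 0 fg fg; rewrite !scale0r !addr0. Qed.

Lemma relB f g f' g' : T (f, g) -> T (f', g') -> T (f - f', g - g').
Proof. by move=> fg fg'; have := rel_comb 1 (-1) fg fg'; rewrite !scale1r !scaleN1r. Qed.

Lemma resolvent_bound z : resolvent_set T z ->
  exists2 M : R, 0 < M & bounded_at T z M.
Proof.
move=> [_ [M MT]]; exists (modulus M + 1); first by rewrite ltr_wpDl ?modulus_ge0.
move=> f g /MT fg.
have e : `|f| <= `|M * `|g| |.
  by rewrite ger0_norm // (le_trans _ fg).
move: e; rewrite normrM normr_id !nrmE modulusE -rcM ler_rc.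
have := nrm_ge0 g; nra.
Qed.

Lemma resolvent_setI z (M : R) : (forall g, exists f, T (f, g + z *: f)) ->
  bounded_at T z M -> resolvent_set T z.
Proof.
move=> ex bd; split; last first.
  by exists (rc M) => f g /bd; rewrite !nrmE -rcM ler_rc.
move=> g; have [f fg] := ex g; exists f; split=> // f' fg'.
apply/eqP; rewrite -subr_eq0 -nrm_eq0 eq_le nrm_ge0 andbT.
rewrite -(mulr0 M) -(@nrm0 R H); apply: bd.
by have := relB fg fg'; congr (T (_, _)); vec.
Qed.

Lemma resolventP z g : resolvent_set T z ->
  T (resolvent T z g, g + z *: resolvent T z g).
Proof.
move=> [ex _]; have [f [fg _]] := ex g.
exact: (@getPex _ [set f | T (f, g + z *: f)] (ex_intro _ f fg)).
Qed.

Lemma resolvent_unique z f g : resolvent_set T z ->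
  T (f, g + z *: f) -> f = resolvent T z g.
Proof.
move=> rz fg; have [ex _] := rz; have [f' [_ u]] := ex g.
by rewrite -(u _ fg) -(u _ (resolventP g rz)).
Qed.

Lemma resolvent_comb z (a b : CC R) g g' : resolvent_set T z ->
  resolvent T z (a *: g + b *: g') = a *: resolvent T z g + b *: resolvent T z g'.
Proof.
move=> rz; apply/esym/resolvent_unique => //.
have := rel_comb a b (resolventP g rz) (resolventP g' rz).
by congr (T (_, _)); vec.
Qed.

Lemma resolventD z g g' : resolvent_set T z ->
  resolvent T z (g + g') = resolvent T z g + resolvent T z g'.
Proof. by move=> rz; have := resolvent_comb 1 1 g g' rz; rewrite !scale1r. Qed.

Lemma resolventB z g g' : resolvent_set T z ->
  resolvent T z (g - g') = resolvent T z g - resolvent T z g'.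
Proof.
by move=> rz; have := resolvent_comb 1 (-1) g g' rz; rewrite !scale1r !scaleN1r.
Qed.

Lemma resolventZ z (a : CC R) g : resolvent_set T z ->
  resolvent T z (a *: g) = a *: resolvent T z g.
Proof.
by move=> rz; have := resolvent_comb a 0 g 0 rz; rewrite !scale0r !addr0.
Qed.

Lemma resolvent_identity z w g : resolvent_set T z -> resolvent_set T w ->
  resolvent T z g - resolvent T w g = (z - w) *: resolvent T z (resolvent T w g).
Proof.
move=> rz rw; rewrite -resolventZ //; apply: resolvent_unique => //.
have := relB (resolventP g rz) (resolventP g rw).
by congr (T (_, _)); vec.
Qed.

Lemma resolventC z w g : resolvent_set T z -> resolvent_set T w ->
  resolvent T z (resolvent T w g) = resolvent T w (resolvent T z g).
Proof.
move=> rz rw; have [->//|zw] := eqVneq z w.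
have zw0 : z - w != 0 by rewrite subr_eq0.
have := resolvent_identity g rw rz; rewrite -opprB resolvent_identity //.
rewrite -scaleNr opprB => /(congr1 (fun x => (w - z)^-1 *: x)).
by rewrite !scalerA mulVf ?scale1r // -opprB oppr_eq0.
Qed.

Lemma resolvent_eigen z w f : resolvent_set T z -> T (f, w *: f) -> w != z ->
  resolvent T z f = (w - z)^-1 *: f.
Proof.
move=> rz fw wz; apply/esym/resolvent_unique => //.
have wz0 : w - z != 0 by rewrite subr_eq0.
have := relZ (w - z)^-1 fw; congr (T (_, _)).
by apply: (in_ext hilbertH) => ?; rewrite !ipE; field.
Qed.

Lemma eigen_not_resolvent z f : f != 0 -> T (f, z *: f) -> spectrum T z.
Proof.
move=> f0 fz rz; move/negP: f0; apply; apply/eqP.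
have -> : f = resolvent T z 0 by apply: resolvent_unique; rewrite ?add0r.
by rewrite -[X in resolvent T z X](scale0r 0) resolventZ // scale0r.
Qed.

(** A relation with a regular point is closed, its resolvent there being bounded and everywhere
    defined: [f] must be the resolvent at [z] of [g - z *: f]. *)
Lemma relation_closed z f g : resolvent_set T z ->
  (forall e : R, 0 < e ->
     exists f' g', [/\ T (f', g'), nrm (f - f') <= e & nrm (g - g') <= e]) ->
  T (f, g).
Proof.
move=> rz cl; have [M M0 bd] := resolvent_bound rz.
set h := resolvent T z (g - z *: f).
have Th : T (h, (g - z *: f) + z *: h) by exact: resolventP.
suff fh : f = h by move: Th; rewrite -fh subrK.
apply/eqP; rewrite -subr_eq0; apply/eqP/nrm_small0 => e e0.
(* Errors e / K in f and in g move f - h by at most (1 + M (1 + |z|)) e / K. *)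
set K := 1 + M * (1 + modulus z).
have K0 : 0 < K.
  by have := modulus_ge0 z; rewrite /K; nra.
have [|f' [g' [fg' fe ge]]] := cl (e / K); first by rewrite divr_gt0.
have hh : nrm (h - f') <= M * nrm ((g - g') - z *: (f - f')).
  by apply: bd; have := relB Th fg'; congr (T (_, _)); vec.
have -> : f - h = (f - f') - (h - f') by vec.
rewrite (le_trans (nrmB _ _)) //.
have := nrmB (g - g') (z *: (f - f')); rewrite nrmZ.
move: fe ge; rewrite !ler_pdivlMr // /K => fe ge nn.
have n1 := nrm_ge0 (f - f'); have n2 := nrm_ge0 (g - g'); have n3 := modulus_ge0 z.
have a1 : M * nrm ((g - g') - z *: (f - f')) <=
   M * (nrm (g - g') + modulus z * nrm (f - f')) by rewrite ler_pM2l.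
have Mz : 0 <= M * modulus z by rewrite mulr_ge0 // ltW.
have [nfe|/ltW nfe] := leP (nrm (f - f')) (nrm (g - g')).
  by have := ler_wpM2l Mz nfe; lra.
by have := ler_wpM2l (ltW M0) nfe; lra.
Qed.

End Linear.

Section Symmetric.
Variable T : set (H * H).
Hypotheses (linT : linear_relation T) (symT : symmetric_relation T).
Hypothesis ppT : pure_point_spectrum T.

Lemma spectrum_real z : spectrum T z -> z = rc (complex.Re z).
Proof.
move=> /ppT[f f0 fz]; apply: conj_fix_real; have := symT fz fz.
rewrite !ipE => /esym; apply: mulIf.
by rewrite in_self // -(rc0 (R := R)) (inj_eq (@rc_inj R)) sqrf_eq0 nrm_eq0.
Qed.

Lemma resolvent_conj z : resolvent_set T z -> resolvent_set T (Num.conj z).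
Proof.
move=> rz; apply: contrapT => sz; have := spectrum_real sz => zr.
apply: sz; suff -> : Num.conj z = z by [].
by rewrite -[RHS]conjCK zr conj_rc.
Qed.

Lemma resolvent_adjoint z g h : resolvent_set T z ->
  << resolvent T z g, h >> = << g, resolvent T (Num.conj z) h >>.
Proof.
move=> rz; have := symT (resolventP g rz) (resolventP h (resolvent_conj rz)).
by rewrite !ipE => /addIr.
Qed.

(** No Neumann series is involved: the lower bound for T - z survives within distance 1 / (2 M) with
    constant 2 M, which rules out eigenvalues there, hence spectrum. *)
Lemma resolvent_open z : resolvent_set T z ->
  exists d M : R, [/\ 0 < d, 0 < M & forall w, modulus (w - z) < d ->
    resolvent_set T w /\ bounded_at T w M].
Proof.
move=> rz; have [M M0 bd] := resolvent_bound rz.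
exists ((2 * M)^-1), (2 * M); have M2 : 0 < 2 * M by rewrite mulr_gt0.
split; rewrite ?invr_gt0 // => w wz.
have bw : bounded_at T w (2 * M).
  move=> f g fg; have /bd : T (f, (g + (w - z) *: f) + z *: f).
    by congr (T (_, _)): fg; vec.
  have := nrmD g ((w - z) *: f); rewrite nrmZ.
  move: wz; rewrite -[_^-1]mul1r ltr_pdivlMr // => wz n1 n2.
  have := nrm_ge0 f; have := nrm_ge0 g; nra.
split=> //; apply: contrapT => /ppT[f f0 fw].
move: f0; rewrite -nrm_gt0 ltNge => /negP; apply.
rewrite -(mulr0 (2 * M)) -(@nrm0 R H); apply: bw; by rewrite add0r.
Qed.

End Symmetric.

End Relations.

(** * Norm bounds for symmetric operators *)

Section SymmetricBound.
Context {R : realType} {H : completeNormedModType (CC R)}.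
Variable ip : {dot H for @Num.conj (CC R)}.
Hypothesis hilbertH : hilbert ip.
Local Notation "<< x , y >>" := (inner ip x y).
Implicit Types (x y v : H).

(* If s is the norm of B on S, then B^2 x - s^2 x is small whenever |B x| is
   close to s |x|, so B - s and B + s cannot both be bounded below on S. *)
Lemma symmetric_operator_bound (S : set H) (B : H -> H) (M s0 : R) :
  (forall (a b : CC R) x y, S x -> S y -> S (a *: x + b *: y)) ->
  (forall x, S x -> S (B x)) ->
  (forall (a b : CC R) x y, S x -> S y -> B (a *: x + b *: y) = a *: B x + b *: B y) ->
  (forall x y, S x -> S y -> << B x, y >> = << x, B y >>) ->
  (forall x, S x -> nrm (B x) <= M * nrm x) ->
  0 <= s0 ->
  (forall s : R, s0 < `|s| -> exists2 k : R, 0 < k &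
     forall y, S y -> k * nrm y <= nrm (B y - rc s *: y)) ->
  forall y, S y -> nrm (B y) <= s0 * nrm y.
Proof.
move=> SD SB BD symB bdB s00 low y Sy.
pose E := [set nrm (B x) | x in [set x | S x /\ nrm x <= 1]].
have S0 : S 0 by have := SD 0 0 _ _ Sy Sy; rewrite !scale0r addr0.
have B0 : B 0 = 0 by have := BD 0 0 _ _ Sy Sy; rewrite !scale0r addr0.
have supE : has_sup E.
  split; first by exists (nrm (B 0)), 0; rewrite //= nrm0 ler01.
  exists (modulus (rc M)) => _ [x [Sx x1] <-]; rewrite modulus_rc.
  rewrite (le_trans (bdB _ Sx)) //.
  have := ler_norm M; have := nrm_ge0 x; have := normr_ge0 M; nra.
have sB x : S x -> nrm (B x) <= sup E * nrm x.
  move=> Sx; have [->|x0] := eqVneq x 0; first by rewrite B0 nrm0 mulr0.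
  have n0 : 0 < nrm x by rewrite nrm_gt0.
  have := BD (rc (nrm x)^-1) 0 _ _ Sx Sx; have := SD (rc (nrm x)^-1) 0 _ _ Sx Sx.
  rewrite !scale0r !addr0 => Sx' Bx'.
  have : nrm (B (rc (nrm x)^-1 *: x)) <= sup E.
    apply: sup_upper_bound => //; exists (rc (nrm x)^-1 *: x) => //; split=> //.
    by rewrite nrmZ modulus_rc ger0_norm ?invr_ge0 ?nrm_ge0 // mulVf // gt_eqF.
  by rewrite Bx' nrmZ modulus_rc ger0_norm ?invr_ge0 ?nrm_ge0 // ler_pdivrMl // mulrC.
set s := sup E in sB.
have [ss0|s0s] := leP s s0.
  by rewrite (le_trans (sB _ Sy)) // ler_wpM2r ?nrm_ge0.
have sp : 0 < s by exact: le_lt_trans s0s.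
exfalso.
have [k1 k10 low1] : exists2 k : R, 0 < k &
     forall y, S y -> k * nrm y <= nrm (B y - rc s *: y).
  by apply: low; rewrite ger0_norm // ltW.
have [k2 k20 low2] : exists2 k : R, 0 < k &
     forall y, S y -> k * nrm y <= nrm (B y - rc (- s) *: y).
  by apply: low; rewrite normrN ger0_norm // ltW.
pose k := k1 * k2.
have k0 : 0 < k by rewrite mulr_gt0.
(* The first bound forces |x| >= 1/2, so |B^2 x - s^2 x|^2 >= k^2 / 4; the second makes the same
   quantity at most 2 s^3 eta <= k^2 / 8. *)
pose eta := Num.min (s / 2) (k ^+ 2 / (16 * s ^+ 3)).
have eta0 : 0 < eta.
  by rewrite lt_min !divr_gt0 //= ?exprn_gt0 // mulr_gt0 // exprn_gt0.
have [_ [x [Sx x1] <-] xs] := sup_adherent eta0 supE.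
rewrite -/s in xs.
have eta1 : eta <= s / 2 by rewrite ge_min lexx.
have eta2 : eta * (16 * s ^+ 3) <= k ^+ 2.
  rewrite -ler_pdivlMr ?ge_min ?lexx ?orbT //; by rewrite mulr_gt0 // exprn_gt0.
(* Factor B^2 - s^2 = (B - s) (B + s) and use the two lower bounds in turn. *)
have kx : k * nrm x <= nrm (B (B x) - rc (s ^+ 2) *: x).
  have Sy' : S (1 *: B x + rc s *: x) by apply: SD => //; exact: SB.
  have := low1 _ Sy'; rewrite (BD 1) //; last exact: SB.
  have -> : 1 *: B (B x) + rc s *: B x - rc s *: (1 *: B x + rc s *: x)
     = B (B x) - rc (s ^+ 2) *: x.
    by apply: (in_ext hilbertH) => ?; rewrite !ipE rcX; ring.
  apply: le_trans; rewrite /k -mulrA ler_pM2l //.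
  by have := low2 _ Sx; rewrite rcN scaleNr opprK scale1r.
(* By symmetry the cross term is -2 s^2 |B x|^2, while |B^2 x| <= s |B x| and |x| <= 1. *)
have sq : nrm (B (B x) - rc (s ^+ 2) *: x) ^+ 2 <= s ^+ 2 * (s ^+ 2 - nrm (B x) ^+ 2).
  rewrite (nrm_sqrD hilbertH) nrmN nrmZ modulus_rc inNr inZr symB //; last exact: SB.
  rewrite in_self // -rcM -rcN Re_rc ger0_norm ?sqr_ge0 //.
  have h1 := sB _ (SB _ Sx).
  have h2 : nrm (B (B x)) ^+ 2 <= (s * nrm (B x)) ^+ 2.
    by rewrite ler_sqr ?nnegrE ?nrm_ge0 // mulr_ge0 ?nrm_ge0 // ltW.
  have h3 : (s ^+ 2 * nrm x) ^+ 2 <= (s ^+ 2) ^+ 2.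
    rewrite ler_sqr ?nnegrE ?mulr_ge0 ?nrm_ge0 ?sqr_ge0 ?(ltW sp) //.
    by rewrite ler_piMr ?sqr_ge0.
  by move: h2 h3; rewrite !exprMn; lra.
have nx : 1 / 2 <= nrm x.
  have := sB _ Sx; move: xs eta1 sp; set a := nrm x; set b := nrm (B x) => *.
  have : s * (1 / 2) <= s * a by lra.
  by rewrite ler_pM2l.
have k4 : k ^+ 2 / 4 <= nrm (B (B x) - rc (s ^+ 2) *: x) ^+ 2.
  have -> : k ^+ 2 / 4 = (k * (1 / 2)) ^+ 2 by field.
  rewrite ler_sqr ?nnegrE ?nrm_ge0 //; last by rewrite mulr_ge0 // ltW.
  by rewrite (le_trans _ kx) // ler_pM2l.
have bs : s ^+ 2 - nrm (B x) ^+ 2 <= 2 * s * eta.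
  have : (s - eta) ^+ 2 <= nrm (B x) ^+ 2.
    rewrite ler_sqr ?nnegrE ?nrm_ge0 //; last by lra.
    by rewrite ltW.
  have := sqr_ge0 eta; lra.
have := ler_wpM2l (sqr_ge0 s) bs.
have : 0 < k ^+ 2 by rewrite exprn_gt0.
by move: eta2 k4 sq; rewrite !exprSr expr0 !mul1r; lra.
Qed.

End SymmetricBound.

Section Completeness.
Context {R : realType} {H : completeNormedModType (CC R)}.

(** Stated for an arbitrary filter since it serves both limits r -> 0+ of resolvents and sums along
    finite subsets. *)
Lemma net_complete (I : Type) (F : set_system I) (FF : ProperFilter F) (u : I -> H) :
  (forall e : R, 0 < e ->
     exists2 A, F A & forall i j, A i -> A j -> nrm (u i - u j) <= e) ->
  exists l, forall e : R, 0 < e -> F [set i | nrm (u i - l) < e].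
Proof.
move=> ucauchy.
have uc : cauchy (u @ F).
  apply: cauchy_exP => e e0 /=.
  have e0' : 0 < complex.Re e by rewrite -ltr_rc rc0 -ge0_rcE // ltW.
  have [|A FA Au] := ucauchy (complex.Re e / 2); first by rewrite divr_gt0.
  have [i Ai] := filter_ex FA.
  exists (u i); rewrite /fmap /=; apply: filterS FA => j Aj /=.
  rewrite -ball_normE /= nrmE (ge0_rcE (ltW e0)) ltr_rc.
  by rewrite (le_lt_trans (Au _ _ Ai Aj)) // ltr_pdivrMr // ltr_pMr // ltr1n.
have /cvg_ex[l ul] : cvg (u @ F) by exact: cauchy_cvg.
exists l => e e0; apply: (ul [set y | nrm (y - l) < e]).
by apply/nbhs_H; exists e.
Qed.

End Completeness.

(** * Isolated points of the spectrum *)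

Section SpectralGap.
Context {R : realType} {H : completeNormedModType (CC R)}.
Variable ip : {dot H for @Num.conj (CC R)}.
Hypothesis hilbertH : hilbert ip.
Local Notation "<< x , y >>" := (inner ip x y).
Variable T : set (H * H).
Hypotheses (linT : linear_relation T) (symT : symmetric_relation ip T).
Hypothesis ppT : pure_point_spectrum T.
Local Notation "'Res' t" := (resolvent T (rc t)) (at level 10, t at level 9).
Implicit Types (t s : R) (f g h y : H).

Ltac vec := apply: (in_ext hilbertH) => ?; rewrite !ipE ?rcD ?rcN; ring.

(** Spectral mapping for the resolvent: T - (t + 1/s) takes [Res t y] to [y - rc s^-1 *: Res t y].
    The hypothesis is thus a lower bound for T at t + 1/s, and the conclusion one for [Res t] at
    s. *)
Lemma resolvent_lower t s (M : R) y : 0 <= M -> s != 0 ->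
  nrm (Res t y) <= M * nrm (y - rc s^-1 *: Res t y) ->
  `|s| / (1 + M / `|s|) * nrm y <= nrm (Res t y - rc s *: y).
Proof.
move=> M0 s0; set f := Res t y => fM.
have sp : 0 < `|s| by rewrite normr_gt0.
have K0 : 0 < 1 + M / `|s| by rewrite ltr_pwDl // divr_ge0 // ltW.
have sc : rc s != 0 by rewrite -rc0 (inj_eq (@rc_inj R)).
have -> : f - rc s *: y = rc (- s) *: (y - rc s^-1 *: f).
  by apply: (in_ext hilbertH) => ?; rewrite !ipE rcN rcV; field.
rewrite nrmZ modulus_rc normrN -mulrA ler_pM2l // ler_pdivrMl //.
have -> : nrm y = nrm ((y - rc s^-1 *: f) + rc s^-1 *: f) by rewrite subrK.
rewrite (le_trans (nrmD _ _)) // nrmZ modulus_rc normfV mulrDl mul1r lerD2l.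
by rewrite mulrAC ler_pdivlMr // mulrC mulrA mulfV ?mul1r // gt_eqF.
Qed.

(** Apply [symmetric_operator_bound] on the whole space with s0 = 1/d: if |s| > 1/d, then t + 1/s
    lies within d of t and is regular, so [resolvent_lower] applies. *)
Lemma resolvent_norm_le t d : 0 < d ->
  (forall s, `|s - t| < d -> resolvent_set T (rc s)) ->
  forall g, nrm (Res t g) <= d^-1 * nrm g.
Proof.
move=> d0 rho g.
have rt : resolvent_set T (rc t) by apply: rho; rewrite subrr normr0.
have [M M0 bd] := resolvent_bound rt.
apply: (@symmetric_operator_bound _ _ ip hilbertH [set: H] _ M) => //.
- by move=> a b x y _ _; exact: (resolvent_comb hilbertH).
- by move=> x y _ _; rewrite (resolvent_adjoint hilbertH symT ppT) // conj_rc.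
- by move=> x _; apply: bd; exact: resolventP.
- by rewrite invr_ge0 ltW.
move=> s ds; have sp : 0 < `|s| by rewrite (le_lt_trans _ ds) // invr_ge0 ltW.
have s0 : s != 0 by rewrite -normr_gt0.
have ru : resolvent_set T (rc (t + s^-1)).
  apply: rho; rewrite addrAC subrr add0r normfV.
  by rewrite -[ltRHS]invrK ltf_pV2 // posrE invr_gt0.
have [M' M'0 bd'] := resolvent_bound ru.
exists (`|s| / (1 + M' / `|s|)).
  by rewrite divr_gt0 // ltr_pwDl // divr_ge0 // ltW.
move=> y _; apply: resolvent_lower => //; first exact: ltW.
apply: bd'; have := resolventP y rt; by congr (T (_, _)); vec.
Qed.

Definition orthogonal_to_kernel t g : Prop :=
  forall e, T (e, rc t *: e) -> << e, g >> = 0.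

Section Isolated.
Variables (lam d : R).
Hypothesis d0 : 0 < d.
Hypothesis isolated_lam : forall t, t != lam -> `|t - lam| < 2 * d ->
  resolvent_set T (rc t).

(** A point closer to t than [lam] differs from [lam] and lies within 2 d of it, hence is regular;
    this is why the gap is taken to be 2 d. *)
Lemma resolvent_norm_near t : t != lam -> `|t - lam| < 2 * d -> `|t - lam| <= d ->
  forall g, nrm (Res t g) <= `|t - lam|^-1 * nrm g.
Proof.
move=> tl t2 td; apply: resolvent_norm_le; first by rewrite normr_gt0 subr_eq0.
move=> s st; apply: isolated_lam.
  by apply: contraTneq st => ->; rewrite distrC ltxx.
have -> : s - lam = (s - t) + (t - lam) by ring.
rewrite (le_lt_trans (ler_normD _ _)) //; lra.
Qed.

(* The points lam + d and lam - d are at distance d from the spectrum, hence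
   2 d |Re <q, p>| <= |q|^2 for all (p, q) in T - lam; at (f + a h, g + a f) and
   (f - a h, g - a f) with a = 2 d, the two bounds together isolate |f|^2. *)
Lemma kernel_range_bound h f g :
  T (h, f + rc lam *: h) -> T (f, g + rc lam *: f) -> 2 * d * nrm f <= nrm g.
Proof.
have d1 := d0; move=> hf fg.
have low (e : R) p q : `|e| = d -> T (p, q + rc lam *: p) ->
    2 * e * complex.Re << q, p >> <= nrm q ^+ 2.
  move=> ed pq.
  have e0 : e != 0 by rewrite -normr_gt0 ed.
  have le1 : lam + e - lam = e by ring.
  have rl : resolvent_set T (rc (lam + e)).
    by apply: isolated_lam; [rewrite -subr_eq0 le1 | rewrite le1 ed ltr_pMl ?ltr1n].
  have := @resolvent_norm_near (lam + e).
  rewrite -subr_eq0 le1 e0 ed lexx => /(_ isT _ isT (q - rc e *: p)).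
  have <- : p = Res (lam + e) (q - rc e *: p).
    apply: (resolvent_unique rl).
    by move: pq; congr (T (_, _)); vec.
  rewrite ler_pdivlMl // => H1.
  have : (d * nrm p) ^+ 2 <= nrm (q - rc e *: p) ^+ 2.
    rewrite ler_sqr ?nnegrE ?nrm_ge0 ?mulr_ge0 ?nrm_ge0 ?(ltW d0) //.
    by apply: H1; lra.
  rewrite (nrm_sqrD hilbertH) nrmN nrmZ modulus_rc ed inNr inZr ReN ReZ; lra.
have symfh : << g, h >> = << f, f >>.
  by have := symT fg hf; rewrite !ipE conj_rc => /addIr.
pose a := 2 * d.
have quad (b : R) : nrm (g + rc b *: f) ^+ 2 =
    nrm g ^+ 2 + 2 * b * complex.Re << g, f >> + b ^+ 2 * nrm f ^+ 2.
  by rewrite (nrm_sqrD hilbertH) inZr ReZ nrmZ modulus_rc exprMn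
    real_normK ?num_real //; ring.
have form (b : R) : complex.Re << g + rc b *: f, f + rc b *: h >> =
    complex.Re << g, f >> + 2 * b * nrm f ^+ 2 + b ^+ 2 * complex.Re << f, h >>.
  rewrite !ipE conj_rc symfh in_self //.
  by rewrite !(ReD, ReZ) !Re_rc; ring.
have shift (b : R) :
    T (f + rc b *: h, (g + rc b *: f) + rc lam *: (f + rc b *: h)).
  have := rel_comb linT 1 (rc b) fg hf; rewrite !scale1r.
  by congr (T (_, _)); vec.
(* Adding the two bounds cancels the terms in <g, f> and <f, h>, leaving 16 d^2 |f|^2 <= 2 |g|^2 + 8
   d^2 |f|^2. *)
have := low d _ _ (gtr0_norm d0) (shift a).
have := low (- d) _ _ _ (shift (- a)); rewrite normrN (gtr0_norm d0) => /(_ erefl).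
rewrite !quad !form => h1 h2.
rewrite -ler_sqr ?nnegrE ?mulr_ge0 ?nrm_ge0 ?(ltW d0) //.
rewrite /a in h1 h2; lra.
Qed.

Lemma resolvent_near t : t != lam -> `|t - lam| < d -> resolvent_set T (rc t).
Proof.
move=> tl td; apply: isolated_lam => //; rewrite (lt_trans td) //.
by rewrite ltr_pMl ?ltr1n.
Qed.

(** The bound does not blow up as t -> lam. If f = (T - lam) h, then [Res t f] is the image of
    [Res t h] under T - lam, so [kernel_range_bound] gives 2 d |Res t f| <= |f + (t - lam) Res t f|,
    and |t - lam| < d absorbs the last term. *)
Lemma resolvent_range_le t h f : t != lam -> `|t - lam| < d ->
  T (h, f + rc lam *: h) -> nrm (Res t f) <= d^-1 * nrm f.
Proof.
have d1 := d0; move=> tl td hf; have rt := resolvent_near tl td.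
have Th := resolventP h rt; have Tf := resolventP f rt.
have e : h = Res t f + rc (lam - t) *: Res t h.
  apply: etrans (_ : Res t (1 *: f + rc (lam - t) *: h) = _); last first.
    by rewrite (resolvent_comb hilbertH) // scale1r.
  apply: (resolvent_unique rt); move: hf; congr (T (_, _)); vec.
have : T (Res t h, Res t f + rc lam *: Res t h).
  move: Th; rewrite {2}e; congr (T (_, _)); vec.
move/kernel_range_bound => /(_ (f + rc (t - lam) *: Res t f)) H1.
have {H1} : 2 * d * nrm (Res t f) <= nrm (f + rc (t - lam) *: Res t f).
  by apply: H1; move: Tf; congr (T (_, _)); vec.
have := nrmD f (rc (t - lam) *: Res t f); rewrite nrmZ modulus_rc.
have := ler_wpM2r (nrm_ge0 (Res t f)) (ltW td).
rewrite ler_pdivlMl //; lra.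
Qed.

(* approximates the orthogonal projection onto the kernel of T - lam *)
Let proj t g := rc (lam - t) *: Res t g.

Lemma defect_range t g : t != lam -> `|t - lam| < d ->
  T (Res t g, (g - proj t g) + rc lam *: Res t g).
Proof.
move=> tl td; have := resolventP g (resolvent_near tl td).
congr (T (_, _)); rewrite /proj; vec.
Qed.

Lemma defect_norm t g : t != lam -> `|t - lam| < d -> nrm (g - proj t g) <= 2 * nrm g.
Proof.
have d1 := d0; move=> tl td; rewrite (le_trans (nrmB _ _)) //.
rewrite /proj nrmZ modulus_rc distrC.
have t0 : 0 < `|t - lam| by rewrite normr_gt0 subr_eq0.
have : nrm (Res t g) <= `|t - lam|^-1 * nrm g.
  apply: resolvent_norm_near => //; last exact: ltW.
  by rewrite (lt_trans td) // ltr_pMl ?ltr1n.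
rewrite ler_pdivlMl //; lra.
Qed.

Lemma resolvent_defect s t g : s != lam -> `|s - lam| < d ->
  t != lam -> `|t - lam| < d -> nrm (Res t (g - proj s g)) <= 2 / d * nrm g.
Proof.
have d1 := d0; move=> sl sd tl td.
have := resolvent_range_le tl td (defect_range g sl sd).
have := defect_norm g sl sd; rewrite !ler_pdivlMl // => h1 h2.
rewrite -mulrA mulrCA ler_pdivlMl //; lra.
Qed.

(* E_t - E_s = E_t (1 - E_s) - E_s (1 - E_t) for E_t = proj t, and 1 - E_s maps
   into the range of T - lam, on which the resolvents stay bounded. *)
Lemma proj_dist s t g : s != lam -> `|s - lam| < d ->
  t != lam -> `|t - lam| < d ->
  nrm (proj t g - proj s g) <= (`|t - lam| + `|s - lam|) * (2 / d * nrm g).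
Proof.
move=> sl sd tl td.
have rs := resolvent_near sl sd; have rt := resolvent_near tl td.
have -> : proj t g - proj s g = rc (lam - t) *: Res t (g - proj s g)
    - rc (lam - s) *: Res s (g - proj t g).
  rewrite !(resolventB hilbertH) // /proj !(resolventZ hilbertH) //.
  rewrite (resolventC hilbertH linT g rs rt); vec.
rewrite (le_trans (nrmB _ _)) // !nrmZ !modulus_rc mulrDl.
rewrite (distrC lam) (distrC lam).
by rewrite lerD // ler_wpM2l // resolvent_defect.
Qed.

Let near_right (c : R) : 0 < c ->
  \forall r \near 0^'+, 0 < r /\ r < c.
Proof.
move=> c0; near=> r; split; near: r; [exact: nbhs_right_gt|exact: nbhs_right_lt].
Unshelve. all: by end_near. Qed.

Let right_ne r : 0 < r -> lam + r != lam.
Proof. by move=> r0; rewrite -subr_eq0 addrAC subrr add0r gt_eqF. Qed.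

Let right_dist r : 0 < r -> `|lam + r - lam| = r.
Proof. by move=> r0; rewrite addrAC subrr add0r gtr0_norm. Qed.

(** By [proj_dist] the approximate projections of g have a limit l. It lies in the kernel of T -
    lam, and it vanishes because it has the same inner product with l as g. *)
Lemma proj_cvg0 g : orthogonal_to_kernel lam g -> forall e : R, 0 < e ->
  \forall r \near 0^'+, nrm (proj (lam + r) g) < e.
Proof.
have d1 := d0; move=> gker.
have [l ul] : exists l, forall e : R, 0 < e ->
    \forall r \near 0^'+, nrm (proj (lam + r) g - l) < e.
  apply: net_complete => e e0.
  pose K := 2 / d * nrm g + 1.
  have K0 : 0 < K by rewrite /K ltr_wpDl // mulr_ge0 ?nrm_ge0 // divr_ge0 // ltW.
  pose c := Num.min d (e / (2 * K)).
  have c0 : 0 < c by rewrite lt_min d1 /= divr_gt0 // mulr_gt0.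
  exists [set r | 0 < r /\ r < c]; first exact: near_right.
  move=> r r' [r0 rc'] [r0' rc''].
  have /andP[rd re] : (r < d) && (r < e / (2 * K)) by rewrite -lt_min.
  have /andP[rd' re'] : (r' < d) && (r' < e / (2 * K)) by rewrite -lt_min.
  have := @proj_dist (lam + r') (lam + r) g (right_ne r0') _ (right_ne r0) _.
  rewrite !right_dist // => /(_ rd' rd) h; apply: (le_trans h).
  move: re re'; rewrite !ltr_pdivlMr ?mulr_gt0 // => re re'.
  have : (r + r') * (2 / d * nrm g) <= (r + r') * K.
    by rewrite ler_wpM2l ?addr_ge0 ?(ltW r0) ?(ltW r0') // /K lerDl.
  lra.
suff l0 : l = 0 by move=> e e0; have := ul e e0; apply: filterS => r; rewrite l0 subr0.
(* T - lam maps [proj t g] to (lam - t) (g - proj t g), which tends to 0; T is closed. *)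
have kl : T (l, rc lam *: l).
  have rd2 : resolvent_set T (rc (lam + d / 2)).
    apply: resolvent_near; first by rewrite right_ne // divr_gt0.
    by rewrite right_dist ?divr_gt0 // ltr_pdivrMr // ltr_pMr // ltr1n.
  apply: (relation_closed hilbertH linT rd2) => e e0.
  pose K := 2 * nrm g + `|lam| + 1.
  have K1 : 1 <= K by rewrite /K lerDr addr_ge0 // mulr_ge0 ?nrm_ge0.
  have K0 : 0 < K by rewrite (lt_le_trans _ K1).
  pose c := Num.min d (e / (2 * K)).
  have eK : 0 < e / (2 * K) by rewrite divr_gt0 // mulr_gt0.
  have c0 : 0 < c by rewrite lt_min d1 /=.
  have [r [rl [r0 rc']]] := filter_ex (filterI (ul _ eK) (near_right c0)).
  have /andP[rd re] : (r < d) && (r < e / (2 * K)) by rewrite -lt_min.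
  have tl := right_ne r0; have td : `|lam + r - lam| < d by rewrite right_dist.
  exists (proj (lam + r) g).
  exists (rc (lam - (lam + r)) *: (g - proj (lam + r) g) + rc lam *: proj (lam + r) g).
  move: rl re; rewrite !ltr_pdivlMr ?mulr_gt0 // => rl re.
  have n0 := nrm_ge0 (proj (lam + r) g - l).
  split.
  - have := relZ linT (rc (lam - (lam + r))) (defect_range g tl td).
    congr (T (_, _)); rewrite /proj; vec.
  - rewrite nrm_distC; nra.
  have -> : rc lam *: l - (rc (lam - (lam + r)) *: (g - proj (lam + r) g)
      + rc lam *: proj (lam + r) g) =
      rc r *: (g - proj (lam + r) g) - rc lam *: (proj (lam + r) g - l) by vec.
  rewrite (le_trans (nrmB _ _)) // !nrmZ !modulus_rc (gtr0_norm r0).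
  have := ler_wpM2l (ltW r0) (defect_norm g tl td).
  have L0 := normr_ge0 lam; have G0 := nrm_ge0 g; rewrite /K in rl re.
  have b1 : r * (2 * nrm g) <= e / 2.
    have : 0 <= r * (`|lam| + 1) by rewrite mulr_ge0 ?addr_ge0 // ltW.
    lra.
  have b2 : `|lam| * nrm (proj (lam + r) g - l) <= e / 2.
    have : 0 <= nrm (proj (lam + r) g - l) * (2 * nrm g + 1).
      by rewrite mulr_ge0 ?addr_ge0 // mulr_ge0.
    lra.
  lra.
(* Since [Res t l] is l / (lam - t), moving the resolvent across gives <l, proj t g> = <l, g> = 0
   for every t near lam; let t -> lam. *)
apply/eqP; rewrite -nrm_eq0 -sqrf_eq0 -(inj_eq (@rc_inj R)) -(in_self hilbertH).
apply/eqP.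
rewrite rc0 -(subr0 << l, l >>) -[X in _ - X](gker _ kl).
apply: (in_small_eq0 hilbertH (x := l) (y := 0)) => e e0.
have [r [rl [r0 rd]]] := filter_ex (filterI (ul _ e0) (near_right d1)).
exists (l - proj (lam + r) g); first by rewrite nrm_distC ltW.
rewrite in0r addr0 inDr inNr; congr (_ - _).
have tl := right_ne r0; have td : `|lam + r - lam| < d by rewrite right_dist.
have rt := resolvent_near tl td.
have lt : rc (lam - (lam + r)) != 0.
  by rewrite -(@rc0 R) (inj_eq (@rc_inj R)) subr_eq0 eq_sym.
have lt' : rc lam - rc (lam + r) != 0 by rewrite -rcN -rcD.
rewrite /proj inZr -[rc (lam + r)]conj_rc -(resolvent_adjoint hilbertH symT ppT) //.
rewrite (resolvent_eigen hilbertH linT rt kl); last by rewrite -subr_eq0.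
rewrite inZl -rcN -rcD -rcV conj_rc mulrA -rcM mulfV ?mul1r //.
by rewrite subr_eq0 eq_sym.
Qed.

(** By [proj_cvg0], g is a limit of vectors g - proj (lam + s) g in the range of T - lam, where the
    resolvents are uniformly bounded. *)
Lemma resolvent_orthogonal_kernel r g : 0 < r -> r < d ->
  orthogonal_to_kernel lam g -> nrm (Res (lam + r) g) <= 2 / d * nrm g.
Proof.
have d1 := d0; move=> r0 rd gker.
have tl := right_ne r0; have td : `|lam + r - lam| < d by rewrite right_dist.
have rt := resolvent_near tl td.
(* Here r is fixed and s is chosen after it: [Res (lam + r)] has norm at most 1/r, so a remainder
   below r e contributes at most e. *)
apply/ler_addgt0Pr => e e0; have re0 : 0 < r * e by rewrite mulr_gt0.
have [s [sg [s0 sd]]] := filter_ex (filterI (proj_cvg0 gker re0) (near_right d1)).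
have sl := right_ne s0; have sd' : `|lam + s - lam| < d by rewrite right_dist.
have -> : Res (lam + r) g = Res (lam + r) (g - proj (lam + s) g) +
    Res (lam + r) (proj (lam + s) g) by rewrite -(resolventD hilbertH) // subrK.
rewrite (le_trans (nrmD _ _)) // lerD ?resolvent_defect //.
have := @resolvent_norm_near (lam + r) tl; rewrite right_dist // => h.
rewrite (le_trans (h _ _ _)) ?(ltW rd) //; first by lra.
by rewrite ler_pdivrMl // ltW.
Qed.

(** The solution f is the limit of [Res (lam + r) g] as r -> 0+. By the resolvent identity
    differences are r - r' times a double resolvent, which stays bounded because [Res (lam + r') g]
    is again orthogonal to the kernel. *)
Lemma isolated_reduced_resolvent : exists2 M : R, 0 < M &
  forall g, orthogonal_to_kernel lam g -> exists f,
    [/\ T (f, g + rc lam *: f), orthogonal_to_kernel lam f & nrm f <= M * nrm g].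
Proof.
have d1 := d0; exists (2 / d); first by rewrite divr_gt0.
move=> g gker; pose u r := Res (lam + r) g.
have uker r : 0 < r -> r < d -> orthogonal_to_kernel lam (u r).
  move=> r0 rd e ke; have tl := right_ne r0.
  have rt : resolvent_set T (rc (lam + r)) by apply: resolvent_near; rewrite ?right_dist.
  rewrite /u -[rc (lam + r)]conj_rc -(resolvent_adjoint hilbertH symT ppT) //.
  rewrite (resolvent_eigen hilbertH linT rt ke) ?inZl ?(gker _ ke) ?mulr0 //.
  by rewrite (inj_eq (@rc_inj R)) eq_sym.
have [f uf] : exists f, forall e : R, 0 < e -> \forall r \near 0^'+, nrm (u r - f) < e.
  apply: net_complete => e e0.
  pose K := 2 / d * (2 / d * nrm g) + 1.
  have K0 : 0 < K.
    have q : 0 <= 2 / d by rewrite divr_ge0 // ltW.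
    by rewrite /K ltr_wpDl // mulr_ge0 // mulr_ge0 ?nrm_ge0.
  pose c := Num.min d (e / K).
  have c0 : 0 < c by rewrite lt_min d1 /= divr_gt0.
  exists [set r | 0 < r /\ r < c]; first exact: near_right.
  move=> r r' [r0 rc'] [r0' rc''].
  have /andP[rd re] : (r < d) && (r < e / K) by rewrite -lt_min.
  have /andP[rd' re'] : (r' < d) && (r' < e / K) by rewrite -lt_min.
  have rt : resolvent_set T (rc (lam + r)).
    by apply: resolvent_near; rewrite ?right_dist ?right_ne.
  have rt' : resolvent_set T (rc (lam + r')).
    by apply: resolvent_near; rewrite ?right_dist ?right_ne.
  rewrite /u (resolvent_identity hilbertH) // nrmZ -rcN -rcD modulus_rc.
  have -> : lam + r - (lam + r') = r - r' by ring.
  have h1 := resolvent_orthogonal_kernel r0 rd (uker _ r0' rd').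
  have h2 := resolvent_orthogonal_kernel r0' rd' gker.
  have q : 0 <= 2 / d by rewrite divr_ge0 // ltW.
  have h3 := le_trans h1 (ler_wpM2l q h2).
  have rr : `|r - r'| <= e / K.
    by rewrite ler_norml; apply/andP; split; lra.
  apply: (le_trans (ler_pM (normr_ge0 _) (nrm_ge0 _) rr h3)).
  by rewrite mulrAC ler_pdivrMr // ler_wpM2l ?(ltW e0) // /K lerDl.
exists f; split.
- have rd2 : resolvent_set T (rc (lam + d / 2)).
    apply: resolvent_near; first by rewrite right_ne // divr_gt0.
    by rewrite right_dist ?divr_gt0 // ltr_pdivrMr // ltr_pMr // ltr1n.
  apply: (relation_closed hilbertH linT rd2) => e e0.
  pose K := 2 / d * nrm g + `|lam| + 1.
  have q : 0 <= 2 / d * nrm g by rewrite mulr_ge0 ?nrm_ge0 // divr_ge0 // ltW.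
  have K1 : 1 <= K by rewrite /K lerDr addr_ge0.
  have K0 : 0 < K by rewrite (lt_le_trans _ K1).
  have eK : 0 < e / (2 * K) by rewrite divr_gt0 // mulr_gt0.
  pose c := Num.min d (e / (2 * K)).
  have c0 : 0 < c by rewrite lt_min d1 /=.
  have [r [rf [r0 rc']]] := filter_ex (filterI (uf _ eK) (near_right c0)).
  have /andP[rd re] : (r < d) && (r < e / (2 * K)) by rewrite -lt_min.
  have rt : resolvent_set T (rc (lam + r)).
    by apply: resolvent_near; rewrite ?right_dist ?right_ne.
  exists (u r), (g + rc (lam + r) *: u r).
  move: rf re; rewrite !ltr_pdivlMr ?mulr_gt0 // => rf re.
  have n0 := nrm_ge0 (u r - f); have L0 := normr_ge0 lam.
  split; first exact: resolventP.
    rewrite nrm_distC; nra.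
  have -> : g + rc lam *: f - (g + rc (lam + r) *: u r) =
    - (rc lam *: (u r - f) + rc r *: u r) by vec.
  rewrite nrmN (le_trans (nrmD _ _)) // !nrmZ !modulus_rc (gtr0_norm r0).
  have := ler_wpM2l (ltW r0) (resolvent_orthogonal_kernel r0 rd gker).
  rewrite -/(u r) => h; rewrite /K in rf re.
  have b1 : r * (2 / d * nrm g) <= e / 2.
    have : 0 <= r * (`|lam| + 1) by rewrite mulr_ge0 ?addr_ge0 // ltW.
    lra.
  have b2 : `|lam| * nrm (u r - f) <= e / 2.
    have : 0 <= nrm (u r - f) * (2 / d * nrm g + 1) by rewrite mulr_ge0 ?addr_ge0.
    lra.
  lra.
- move=> e ke; apply: (in_small_eq0 hilbertH (x := e) (y := 0)) => eps eps0.
  have [r [rf [r0 rd]]] := filter_ex (filterI (uf _ eps0) (near_right d1)).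
  exists (f - u r); first by rewrite nrm_distC ltW.
  by rewrite in0r addr0 inDr inNr (uker _ r0 rd _ ke) subr0.
apply/ler_addgt0Pr => e e0.
have [r [rf [r0 rd]]] := filter_ex (filterI (uf _ e0) (near_right d1)).
have -> : f = u r - (u r - f) by vec.
rewrite (le_trans (nrmB _ _)) // lerD ?(ltW rf) //.
exact: resolvent_orthogonal_kernel.
Qed.

End Isolated.
End SpectralGap.

(** * Completeness of the eigenvectors *)

Section PurePointRelations.
Context {R : realType} {H : completeNormedModType (CC R)}.
Variable ip : {dot H for @Num.conj (CC R)}.
Hypothesis hilbertH : hilbert ip.
Local Notation "<< x , y >>" := (inner ip x y).
Variable T : set (H * H).
Hypotheses (linT : linear_relation T) (symT : symmetric_relation ip T).
Hypothesis ppT : pure_point_spectrum T.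
Hypothesis discreteT : forall lam : R, exists2 d, 0 < d &
  forall t, t != lam -> `|t - lam| < d -> resolvent_set T (rc t).
Local Notation "'Res' t" := (resolvent T (rc t)) (at level 10, t at level 9).

Lemma reduced_resolvent (lam : R) : exists2 M : R, 0 < M &
  forall g, orthogonal_to_kernel ip T lam g -> exists f,
    [/\ T (f, g + rc lam *: f), orthogonal_to_kernel ip T lam f & nrm f <= M * nrm g].
Proof.
have [d d0 iso] := discreteT lam.
apply: (isolated_reduced_resolvent (d := d / 2) hilbertH linT symT ppT).
  by rewrite divr_gt0.
by move=> t tl td; apply: iso => //; apply: (lt_le_trans td); rewrite mulrC divfK.
Qed.

(** By symmetry g is orthogonal to the kernel too; f and the solution from [reduced_resolvent] then
    differ by a kernel vector orthogonal to the kernel, which is 0. *)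
Lemma reduced_resolvent_bound (lam : R) : exists2 M : R, 0 < M &
  forall f g, orthogonal_to_kernel ip T lam f -> T (f, g + rc lam *: f) ->
    nrm f <= M * nrm g.
Proof.
have [M M0 red] := reduced_resolvent lam; exists M => // f g fker fg.
have gker : orthogonal_to_kernel ip T lam g.
  move=> e ke; have := symT ke fg.
  by rewrite inDr inZr inZl (fker _ ke) !mulr0 addr0.
have [f' [fg' fker' fM]] := red g gker.
suff -> : f = f' by [].
have k : T (f - f', rc lam *: (f - f')).
  have := relB linT fg fg'; congr (T (_, _)).
  by apply: (in_ext hilbertH) => ?; rewrite !ipE; ring.
apply/eqP; rewrite -subr_eq0 -nrm_eq0 -sqrf_eq0 -(inj_eq (@rc_inj R)).
by rewrite -(in_self hilbertH) inDr inNr (fker _ k) (fker' _ k) subr0.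
Qed.

(** The conclusion is membership in the multivalued part, not v = 0: that part is the kernel of
    every resolvent and escapes the eigenvectors. *)
Lemma orthogonal_to_eigenvectors v :
  (forall lam, orthogonal_to_kernel ip T lam v) -> T (0, v).
Proof.
(* Zero may itself be an eigenvalue; c is a regular real point beside it. *)
move=> vker; have [d d0 rho] := discreteT 0; pose c := d / 2.
have cp : 0 < c by rewrite divr_gt0.
have rc_c : resolvent_set T (rc c).
  apply: rho; first by rewrite gt_eqF.
  by rewrite subr0 gtr0_norm // /c ltr_pdivrMr // ltr_pMr // ltr1n.
have [M M0 bd] := resolvent_bound rc_c.
pose S := [set v : H | forall lam, orthogonal_to_kernel ip T lam v].
have SB x : S x -> S (Res c x).
  move=> Sx lam e ke; have [lc|lc] := eqVneq lam c.
    have [->|e0] := eqVneq e 0; first by rewrite in0l.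
    by have := eigen_not_resolvent hilbertH linT e0 ke; rewrite lc => /(_ rc_c).
  rewrite -[rc c]conj_rc -(resolvent_adjoint hilbertH symT ppT) //.
  rewrite (resolvent_eigen hilbertH linT rc_c ke) ?inZl ?(Sx _ _ ke) ?mulr0 //.
  by rewrite (inj_eq (@rc_inj R)).
suff Bv : Res c v = 0 by have := resolventP v rc_c; rewrite Bv scaler0 addr0.
apply/eqP; rewrite -nrm_eq0 eq_le nrm_ge0 andbT -(mul0r (nrm v)).
apply: (@symmetric_operator_bound _ _ ip hilbertH S _ M) => //.
- move=> a b x y Sx Sy lam e ke.
  by rewrite inDr !inZr (Sx _ _ ke) (Sy _ _ ke) !mulr0 addr0.
- by move=> a b x y _ _; exact: (resolvent_comb hilbertH).
- by move=> x y _ _; rewrite (resolvent_adjoint hilbertH symT ppT) // conj_rc.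
- by move=> x _; apply: bd; exact: resolventP.
(* The point c + 1/s may be an eigenvalue, but vectors of S are orthogonal to its kernel, so the
   reduced bound is enough. *)
move=> s sp; have s0 : s != 0 by rewrite -normr_gt0.
have [M' M'0 red] := reduced_resolvent_bound (c + s^-1).
exists (`|s| / (1 + M' / `|s|)).
  by rewrite divr_gt0 // ltr_pwDl // divr_ge0 // ltW.
move=> y Sy; apply: (resolvent_lower hilbertH) => //; first exact: ltW.
apply: red; first exact: SB.
have := resolventP y rc_c; congr (T (_, _)).
by apply: (in_ext hilbertH) => ?; rewrite !ipE rcD; ring.
Qed.

End PurePointRelations.

(** * Orthogonal series *)

#[local] Existing Instance summability.totally_filter.

Section BoundedSums.
Context {R : realType} {I : choiceType}.
Variable w : I -> R.
Hypothesis w0 : forall i, 0 <= w i.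

Lemma esum_lt_pinfty : (\esum_(i in [set: I]) (w i)%:E < +oo)%E <->
  exists M : R, forall B : {fset I}, \sum_(i <- B) w i <= M.
Proof.
split=> [wfin|[M BM]].
  have s0 : (0 <= \esum_(i in [set: I]) (w i)%:E)%E.
    by apply: esum_ge0 => i _; rewrite lee_fin.
  exists (fine (\esum_(i in [set: I]) (w i)%:E)) => B.
  rewrite -lee_fin fineK; last by rewrite ge0_fin_numE.
  apply: esum_ge; exists [set` B]; first by split.
  by rewrite fsbig_finite //= set_fsetK sumEFin.
apply: (@le_lt_trans _ _ M%:E); last exact: ltry.
apply: ge_ereal_sup => _ [A [finA _] <-].
by rewrite fsbig_finite // sumEFin lee_fin.
Qed.

(** Take for B0 a finite set whose sum is within e of the supremum. *)
Lemma bounded_sum_tail (M : R) : (forall B : {fset I}, \sum_(i <- B) w i <= M) ->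
  forall e : R, 0 < e -> exists B0 : {fset I}, forall B : {fset I},
    (B0 `<=` B)%fset -> \sum_(i <- B | i \notin B0) w i <= e.
Proof.
move=> BM e e0; pose E := [set \sum_(i <- B) w i | B in [set: {fset I}]].
have supE : has_sup E.
  split; first by exists (\sum_(i <- fset0) w i), fset0.
  by exists M => _ [B _ <-].
have [_ [B0 _ <-] hB0] := sup_adherent e0 supE.
exists B0 => B B0B.
have : \sum_(i <- B) w i <= sup E by apply: sup_upper_bound => //; exists B.
rewrite (bigID (mem B0)) /=.
suff -> : \sum_(i <- B | i \in B0) w i = \sum_(i <- B0) w i by lra.
rewrite big_fset_condE; apply: perm_big.
apply: uniq_perm; rewrite ?fset_uniq // => i.
by rewrite !inE; apply/andP/idP => [[]|] // iB0; split=> //; exact: (fsubsetP B0B).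
Qed.

End BoundedSums.

Section OrthogonalFamilies.
Context {R : realType} {H : completeNormedModType (CC R)}.
Variable ip : {dot H for @Num.conj (CC R)}.
Hypothesis hilbertH : hilbert ip.
Local Notation "<< x , y >>" := (inner ip x y).
Context {I : choiceType}.
Variable (eta : I -> H).
Hypothesis orth : forall i j, i != j -> << eta i, eta j >> = 0.
Implicit Type a : I -> CC R.

(** The squared norm of the i-th term; for the eigenvectors at infinite coupling it becomes |c_n|^2
    F'(x_n). *)
Definition weight a i : R := modulus (a i) ^+ 2 * nrm (eta i) ^+ 2.

Lemma weight_ge0 a i : 0 <= weight a i.
Proof. by rewrite mulr_ge0 ?sqr_ge0. Qed.

Lemma nrm_sqr_orthogonal_sum a (P : pred I) (s : seq I) : uniq s ->
  nrm (\sum_(i <- s | P i) a i *: eta i) ^+ 2 = \sum_(i <- s | P i) weight a i.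
Proof.
elim: s => [|i s IHs] /=; first by rewrite !big_nil nrm0 expr0n.
move=> /andP[is_ us]; rewrite !big_cons; case: ifP => [Pi|_]; last exact: IHs.
rewrite (nrm_sqrD hilbertH) IHs // nrmZ exprMn; congr (_ + _).
rewrite in_sumr big_seq_cond big1 => [|j /andP[js _]]; first by rewrite mulr0 addr0.
rewrite inZl inZr orth ?mulr0 //; apply: contraNneq is_ => ->; exact: js.
Qed.

Lemma partial_sumE (V : zmodType) (f : I -> V) (B : {fset I}) :
  summability.partial_sum f B = \sum_(i <- B) f i.
Proof. by rewrite /summability.partial_sum big_seq_fsetE. Qed.

Lemma nrm_partial_sumB a (B0 B : {fset I}) : (B0 `<=` B)%fset ->
  nrm (summability.partial_sum (fun i => a i *: eta i) B -
       summability.partial_sum (fun i => a i *: eta i) B0) ^+ 2 =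
  \sum_(i <- B | i \notin B0) weight a i.
Proof.
move=> B0B; rewrite !partial_sumE (bigID (mem B0)) /=.
have -> : \sum_(i <- B | i \in B0) a i *: eta i = \sum_(i <- B0) a i *: eta i.
  rewrite big_fset_condE; apply: perm_big.
  apply: uniq_perm; rewrite ?fset_uniq // => i.
  by rewrite !inE; apply/andP/idP => [[]|] // iB0; split=> //; exact: (fsubsetP B0B).
by rewrite addrAC subrr add0r nrm_sqr_orthogonal_sum.
Qed.

Lemma orthogonal_series_cvg a (M : R) :
  (forall B : {fset I}, \sum_(i <- B) weight a i <= M) ->
  exists psi, forall e : R, 0 < e -> summability.totally
    [set B | nrm (summability.partial_sum (fun i => a i *: eta i) B - psi) < e].
Proof.
move=> BM; apply: net_complete => e e0.
have e2 : 0 < (e / 2) ^+ 2 by rewrite exprn_gt0 // divr_gt0.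
have [B0 tail] := bounded_sum_tail BM e2.
exists [set B | (B0 `<=` B)%fset]; first by exists B0.
have close B : (B0 `<=` B)%fset ->
    nrm (summability.partial_sum (fun i => a i *: eta i) B -
       summability.partial_sum (fun i => a i *: eta i) B0) <= e / 2.
  move=> B0B; rewrite -ler_sqr ?nnegrE ?nrm_ge0 ?divr_ge0 ?(ltW e0) //.
  by rewrite nrm_partial_sumB // tail.
move=> B B' /close h /close h'.
rewrite -[_ - _](subrKA (summability.partial_sum (fun i => a i *: eta i) B0)).
by rewrite (le_trans (nrmD _ _)) // [X in _ + X]nrm_distC; lra.
Qed.

(** The a_i are the Fourier coefficients of phi, so the partial sum u is an orthogonal projection
    and |phi - u|^2 = |phi|^2 - |u|^2. *)
Lemma Bessel a phi (B : {fset I}) :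
  (forall i, << eta i, phi >> = a i * rc (nrm (eta i) ^+ 2)) ->
  \sum_(i <- B) weight a i <= nrm phi ^+ 2.
Proof.
move=> aE; pose u := \sum_(i <- B) a i *: eta i.
have : 0 <= nrm (phi - u) ^+ 2 by exact: sqr_ge0.
rewrite (nrm_sqrD hilbertH) nrmN inNr ReN.
have -> : << phi, u >> = rc (\sum_(i <- B) weight a i).
  rewrite /u in_sumr (big_morph _ (@rcD R) (@rc0 R)); apply: eq_bigr => i _.
  rewrite inZr (inC ip (eta i)) aE conjM conj_rc mulrA [a i * _]mulrC mulconj.
  by rewrite -rcM.
by rewrite Re_rc /u (nrm_sqr_orthogonal_sum a xpredT) ?fset_uniq //; lra.
Qed.

End OrthogonalFamilies.

(** * The rank one perturbation at infinite coupling *)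

Section RankOnePerturbation.
Context {R : realType} {H : completeNormedModType (CC R)}.
Variables (ip : {dot H for @Num.conj (CC R)}) (A : set (H * H)) (mu : H).
Hypothesis hilbertH : hilbert ip.
Hypothesis selfadjointA : self_adjoint_operator ip A.
Hypothesis discreteA : simple_discrete_spectrum A.
Hypothesis cyclic_mu : cyclic_vector A mu.
Hypothesis norm_mu : `|mu| = 1.
Local Notation "<< x , y >>" := (inner ip x y).
Local Notation F := (borel_transform ip A mu).
Local Notation Aoo := (infinite_coupling ip A mu).
Local Notation Res := (resolvent A).
Implicit Types (z w x : CC R) (f g e v : H).

Ltac vec := apply: (in_ext hilbertH) => ?; rewrite !ipE; ring.

Lemma nrm_mu : nrm mu = 1.
Proof. by apply: rc_inj; rewrite -nrmE norm_mu. Qed.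

Lemma linear_A : linear_relation A. Proof. by case: selfadjointA. Qed.

Lemma symmetric_A : symmetric_relation ip A.
Proof.
case: selfadjointA => _ _ _ adjA f g f' g' fg fg'.
by move: fg; rewrite -adjA => /(_ _ _ fg').
Qed.

Lemma operator_A0 g : A (0, g) -> g = 0.
Proof. by case: selfadjointA => -[A0 _] sv _ _ Ag; exact: sv Ag A0. Qed.

Lemma pure_point_A : pure_point_spectrum A.
Proof.
move=> z /discreteA[_ [e e0 Ez]]; exists e => //.
suff : Defs.eigenspace A z e by [].
by rewrite Ez; exists 1 => //; rewrite scale1r.
Qed.

Lemma discrete_A (lam : R) : exists2 d, 0 < d &
  forall t, t != lam -> `|t - lam| < d -> resolvent_set A (rc t).
Proof.
have [rl|/discreteA[[_ [V /nbhs_CC[d d0 dV] VA]] _]] :=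
  pselect (resolvent_set A (rc lam)).
  have [d [M [d0 _ dr]]] := resolvent_open hilbertH pure_point_A rl.
  exists d => // t _ td; have [] // := dr (rc t).
  by rewrite -rcN -rcD modulus_rc.
exists d => // t tl td; apply: contrapT => st.
have : (V `&` spectrum A) (rc t).
  by split=> //; apply: dV; rewrite -rcN -rcD modulus_rc.
by rewrite VA /= => /rc_inj /eqP; apply/negP.
Qed.

Lemma resolvent_set_conj z : resolvent_set A z -> resolvent_set A (Num.conj z).
Proof. exact: (resolvent_conj hilbertH symmetric_A pure_point_A). Qed.

Lemma resolvent_adj z g v : resolvent_set A z ->
  << Res z g, v >> = << g, Res (Num.conj z) v >>.
Proof. exact: (resolvent_adjoint hilbertH symmetric_A pure_point_A). Qed.

(** The resolvent identity seen from mu. It yields the orthogonality of eigenvectors (two zeros of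
    F), the isolation of the zeros and the value of F'. *)
Lemma borelB z w : resolvent_set A z -> resolvent_set A w ->
  F z - F w = (z - w) * << Res (Num.conj z) mu, Res w mu >>.
Proof.
move=> rz rw; rewrite (resolvent_adj _ _ (resolvent_set_conj rz)) conjCK.
rewrite -inZr -(resolvent_identity hilbertH linear_A) //.
by rewrite inDr inNr.
Qed.

Lemma resolvent_mu_neq0 z : resolvent_set A z -> Res z mu != 0.
Proof.
move=> rz; apply/eqP => R0; have := resolventP mu rz.
rewrite R0 scaler0 addr0 => /operator_A0 mu0.
by have := nrm_mu; rewrite mu0 nrm0 => /esym/eqP; rewrite oner_eq0.
Qed.

(** If e were orthogonal to mu, it would be orthogonal to every [Res w mu], hence to a dense set. *)
Lemma cyclic_eigenvector z e : e != 0 -> A (e, z *: e) -> << mu, e >> != 0.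
Proof.
move=> e0 Ae; apply/eqP => mue.
have ne : 0 < nrm e by rewrite nrm_gt0.
(* A vector orthogonal to e is at distance at least |e| from e, so this ball contains none. *)
have [] := cyclic_mu (O := ball e (rc (nrm e))).
- by exists e; apply: ballxx; rewrite ltr_rc.
- exact: ball_open.
move=> v [bv [n [a [x [Xx vE]]]]].
have ve : << v, e >> = 0.
  rewrite vE in_suml big1 // => i _; rewrite inZl.
  have [w rw <-] := Xx i; move: rw => /contrapT rw.
  rewrite resolvent_adj //.
  have rw' := resolvent_set_conj rw.
  have wz : z != Num.conj w.
    apply: contraTneq isT => zw.
    by have := eigen_not_resolvent hilbertH linear_A e0 Ae; rewrite zw => /(_ rw').
  by rewrite (resolvent_eigen hilbertH linear_A rw' Ae wz) inZr mue !mulr0.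
move: bv; rewrite -ball_normE /= nrmE ltr_rc => bv.
have := CauchySchwarz hilbertH (e - v) e.
rewrite inDl inNl ve subr0 (in_self hilbertH) modulus_rc (ger0_norm (sqr_ge0 _)).
by rewrite expr2 ler_pM2r // leNgt bv.
Qed.

(** * The spectrum at infinite coupling *)

Lemma linear_oo : linear_relation Aoo.
Proof.
have [A0 AD] := linear_A; split.
  by split; rewrite /= ?in0r //; exists 0; rewrite scale0r subr0.
move=> a [f g] [f' g'] [/= f0 [c fg]] [/= f'0 [c' fg']]; split => /=.
  by rewrite inDr inZr f0 f'0 mulr0 addr0.
exists (a * c + c'); have := rel_comb linear_A a 1 fg fg'.
by rewrite scale1r; congr (A (_, _)); vec.
Qed.

Lemma symmetric_oo : symmetric_relation ip Aoo.
Proof.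
move=> f g f' g' [/= f0 [c fg]] [/= f'0 [c' fg']].
have := symmetric_A fg fg'.
by rewrite !ipE f'0 (inC _ mu f) f0 conjC0 !mulr0 !subr0.
Qed.

(** Krein's formula at infinite coupling: the resolvent of [Aoo] sends g to
    [Res z g - c *: Res z mu], where <mu, f> = 0 forces c = <mu, Res z g> / F z. *)
Lemma resolvent_oo_regular z : resolvent_set A z -> F z != 0 -> resolvent_set Aoo z.
Proof.
move=> rz Fz; have [M M0 bd] := resolvent_bound rz.
have RM g : nrm (Res z g) <= M * nrm g by apply: bd; exact: resolventP.
apply: (resolvent_setI hilbertH linear_oo (M := M + M * (M / modulus (F z)))).
  move=> g; pose c := << mu, Res z g >> / F z.
  exists (Res z g - c *: Res z mu); split=> /=.
    by rewrite inDr inNr inZr -/(F z) divfK // subrr.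
  exists c; have := rel_comb linear_A 1 (- c) (resolventP g rz) (resolventP mu rz).
  by rewrite !scale1r scaleNr; congr (A (_, _)); vec.
move=> f g [/= f0 [c fg]].
have fE : f = Res z g - c *: Res z mu.
  rewrite -(resolventZ hilbertH linear_A) // -(resolventB hilbertH linear_A) //.
  by apply: (resolvent_unique rz); move: fg; congr (A (_, _)); vec.
have cE : c = << mu, Res z g >> / F z.
  move: f0; rewrite fE inDr inNr inZr -/(F z) => /eqP; rewrite subr_eq0 => /eqP ->.
  by rewrite mulfK.
have F0 : 0 < modulus (F z) by rewrite modulus_gt0.
rewrite fE (le_trans (nrmB _ _)) // mulrDl lerD // nrmZ.
have := RM mu; rewrite nrm_mu mulr1 => Rmu.
have cM : modulus c <= M / modulus (F z) * nrm g.
  rewrite cE modulusM modulusV mulrAC ler_pM2r ?invr_gt0 //.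
  by rewrite (le_trans (CauchySchwarz hilbertH _ _)) // nrm_mu mul1r.
rewrite [leLHS]mulrC -mulrA.
by rewrite ler_pM // ?nrm_ge0 ?modulus_ge0.
Qed.

(** Let e span the kernel of A - z. Since <mu, e> != 0, solvability of (A - z) f = g - c mu fixes c
    by <e, g - c mu> = 0, and <mu, f> = 0 fixes the free multiple of e in f. *)
Lemma resolvent_oo_pole z : spectrum A z -> resolvent_set Aoo z.
Proof.
move=> sz; have zr := spectrum_real hilbertH symmetric_A pure_point_A sz.
move: sz; rewrite zr; set lam := complex.Re z => sz.
have [_ [e e0 Ez]] := discreteA sz.
have Ee : A (e, rc lam *: e).
  suff : Defs.eigenspace A (rc lam) e by [].
  by rewrite Ez; exists 1 => //; rewrite scale1r.
have mue := cyclic_eigenvector e0 Ee.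
have emu : << e, mu >> != 0 by rewrite inC conjC_eq0.
have kerE g : << e, g >> = 0 -> orthogonal_to_kernel ip A lam g.
  move=> eg k Ak; have : Defs.eigenspace A (rc lam) k by [].
  by rewrite Ez => -[a _ <-]; rewrite inZl eg mulr0.
have [M M0 red] := reduced_resolvent hilbertH linear_A symmetric_A pure_point_A
  discrete_A lam.
(* K bounds both corrections: |c mu| <= K |g|, and the multiple of e added to a solution h has norm
   at most K |h|. *)
pose K := nrm e / modulus << mu, e >>.
have K0 : 0 <= K by rewrite divr_ge0 ?nrm_ge0 ?modulus_ge0.
apply: (resolvent_setI hilbertH linear_oo (M := (1 + K) * (M * (1 + K)))).
  move=> g; pose c := << e, g >> / << e, mu >>.
  have [|f [fg _ _]] := red (g - c *: mu).
    by apply: kerE; rewrite inDr inNr inZr divfK // subrr.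
  exists (f - (<< mu, f >> / << mu, e >>) *: e); split=> /=.
    by rewrite inDr inNr inZr divfK // subrr.
  exists c; have := rel_comb linear_A 1 (- (<< mu, f >> / << mu, e >>)) fg Ee.
  by rewrite !scale1r scaleNr; congr (A (_, _)); vec.
move=> f g [/= f0 [c fg]].
have cE : c = << e, g >> / << e, mu >>.
  have := symmetric_A Ee fg; rewrite !ipE conj_rc => E.
  suff -> : << e, g >> = c * << e, mu >> by rewrite mulfK.
  apply/eqP; rewrite -subr_eq0 -(subrr (rc lam * << e, f >>)) -{1}E.
  by apply/eqP; ring.
have [|h [hg _ hM]] := red (g - c *: mu).
  by apply: kerE; rewrite inDr inNr inZr cE divfK // subrr.
have : Defs.eigenspace A (rc lam) (f - h).
  have := relB linear_A fg hg; congr (A (_, _)); vec.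
rewrite Ez => -[a _ fh].
have fE : f = h + a *: e by rewrite fh addrC subrK.
have aE : a = - (<< mu, h >> / << mu, e >>).
  move: f0; rewrite fE inDr inZr => /eqP; rewrite addrC addr_eq0 -mulNr => /eqP <-.
  by rewrite mulfK.
have me0 : 0 < modulus << mu, e >> by rewrite modulus_gt0.
have h1 : nrm f <= (1 + K) * nrm h.
  rewrite fE (le_trans (nrmD _ _)) // mulrDl mul1r lerD2l nrmZ aE.
  rewrite modulusN modulusM modulusV.
  rewrite /K mulrC -!mulrA ler_wpM2l ?nrm_ge0 // mulrC ler_pM2l ?invr_gt0 //.
  by rewrite (le_trans (CauchySchwarz hilbertH _ _)) // nrm_mu mul1r.
have h2 : nrm (g - c *: mu) <= (1 + K) * nrm g.
  rewrite (le_trans (nrmB _ _)) // mulrDl mul1r lerD2l nrmZ nrm_mu mulr1 cE.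
  rewrite modulusM modulusV [in (modulus << e, mu >>)^-1]inC modulus_conj /K mulrAC.
  by rewrite ler_pM2r ?invr_gt0 // (CauchySchwarz hilbertH).
rewrite (le_trans h1) // -mulrA ler_wpM2l ?addr_ge0 // (le_trans hM) //.
by rewrite -mulrA ler_pM2l.
Qed.

Lemma eigenvector_oo z : resolvent_set A z -> F z = 0 -> Aoo (Res z mu, z *: Res z mu).
Proof.
move=> rz Fz; split=> //=; exists (-1).
by rewrite scaleN1r opprK addrC; exact: resolventP.
Qed.

Lemma spectrum_oo z : spectrum Aoo z <-> resolvent_set A z /\ F z = 0.
Proof.
split=> [sz|[rz Fz]].
  have rz : resolvent_set A z.
    by apply: contrapT => /resolvent_oo_pole.
  split=> //; apply/eqP/negPn/negP => Fz.
  exact: sz (resolvent_oo_regular rz Fz).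
apply: (eigen_not_resolvent hilbertH linear_oo (resolvent_mu_neq0 rz)).
exact: eigenvector_oo.
Qed.

Lemma pure_point_oo : pure_point_spectrum Aoo.
Proof.
move=> z /spectrum_oo[rz Fz]; exists (Res z mu); first exact: resolvent_mu_neq0.
exact: eigenvector_oo.
Qed.

Lemma resolvent_lipschitz z : resolvent_set A z ->
  exists d M : R, [/\ 0 < d, 0 < M & forall w g, modulus (w - z) < d ->
    resolvent_set A w /\
    nrm (Res w g - Res z g) <= modulus (w - z) * (M * nrm (Res z g))].
Proof.
move=> rz; have [d [M [d0 M0 dM]]] := resolvent_open hilbertH pure_point_A rz.
exists d, M; split=> // w g /dM[rw bw]; split=> //.
rewrite (resolvent_identity hilbertH linear_A) // nrmZ ler_wpM2l ?modulus_ge0 //.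
by apply: bw; exact: resolventP.
Qed.

(** Zeros of F are isolated without complex analysis: if F lam = 0, then F t is t - lam times <Res t
    mu, Res lam mu>, which is near |Res lam mu|^2 > 0. *)
Lemma discrete_oo (lam : R) : exists2 d, 0 < d &
  forall t, t != lam -> `|t - lam| < d -> resolvent_set Aoo (rc t).
Proof.
have [rl|/spectrum_oo[rl Fl]] := pselect (resolvent_set Aoo (rc lam)).
  have [d [M [d0 _ dr]]] := resolvent_open hilbertH pure_point_oo rl.
  exists d => // t _ td; have [] // := dr (rc t).
  by rewrite -rcN -rcD modulus_rc.
have [d [M [d0 M0 dM]]] := resolvent_lipschitz rl.
(* If that inner product vanished, then |eta|^2 <= |t - lam| M |eta|^2, so |t - lam| >= 1/M. *)
exists (Num.min d M^-1); first by rewrite lt_min d0 invr_gt0.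
move=> t tl; rewrite lt_min => /andP[td tM].
have mt : modulus (rc t - rc lam) = `|t - lam| by rewrite -rcN -rcD modulus_rc.
have [|rt ht] := dM (rc t) mu; first by rewrite mt.
apply: resolvent_oo_regular => //.
have := borelB rt rl; rewrite Fl subr0 conj_rc => ->.
have t0 : rc t - rc lam != 0 by rewrite subr_eq0 (inj_eq (@rc_inj R)).
rewrite mulf_neq0 //; apply/eqP => orth.
set eta := Res (rc lam) mu in ht orth.
have n0 : 0 < nrm eta by rewrite nrm_gt0 resolvent_mu_neq0.
have := CauchySchwarz hilbertH (Res (rc t) mu - eta) eta.
rewrite inDl inNl orth sub0r modulusN (in_self hilbertH) modulus_rc.
rewrite (ger0_norm (sqr_ge0 _)).
rewrite expr2 ler_pM2r // => h; have := le_trans h ht.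
rewrite mt mulrA -[leLHS]mul1r ler_pM2r // leNgt => /negP; apply.
by rewrite -ltr_pdivlMr // mul1r.
Qed.

Lemma spectrum_oo_real x : spectrum Aoo x -> x = rc (complex.Re x).
Proof. exact: (spectrum_real hilbertH symmetric_oo pure_point_oo). Qed.

Lemma resolvent_oo_conj z : resolvent_set Aoo z -> resolvent_set Aoo (Num.conj z).
Proof. exact: (resolvent_conj hilbertH symmetric_oo pure_point_oo). Qed.

(** Orthogonality to the eigenvectors puts v in the multivalued part of [Aoo], so v = c mu as A is
    single-valued; orthogonality to mu then kills it. *)
Lemma orthogonal_to_mu_and_eigenvectors v : << mu, v >> = 0 ->
  (forall x, spectrum Aoo x -> << Res x mu, v >> = 0) -> v = 0.
Proof.
move=> muv ev.
have [/= _ [c]] : Aoo (0, v).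
  apply: (orthogonal_to_eigenvectors hilbertH linear_oo symmetric_oo pure_point_oo
    discrete_oo) => lam e ke.
  have [->|e0] := eqVneq e 0; first by rewrite in0l.
  have slam := eigen_not_resolvent hilbertH linear_oo e0 ke.
  have [rl _] := (spectrum_oo _).1 slam.
  case: ke => /= _ [c Ae].
  (* Every eigenvector of [Aoo] at lam is a multiple of [Res (rc lam) mu]. *)
  have -> : e = Res (rc lam) ((- c) *: mu).
    by apply: (resolvent_unique rl); move: Ae; congr (A (_, _)); vec.
  by rewrite (resolventZ hilbertH linear_A) // inZl ev ?mulr0.
move=> /operator_A0 /eqP; rewrite subr_eq0 => /eqP vc.
apply/eqP; rewrite -nrm_eq0 -sqrf_eq0 -(inj_eq (@rc_inj R)) -(in_self hilbertH).
by rewrite {1}vc inZl muv mulr0.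
Qed.

(** By [borelB] the difference quotient is <Res (conj (x + h)) mu, Res x mu>, within M |h| |Res x
    mu|^2 of the claimed value, since x is real. *)
Lemma derive1_borel x : spectrum Aoo x ->
  derive1 F x = rc (nrm (Res x mu) ^+ 2).
Proof.
move=> sx; have [rx Fx] := (spectrum_oo x).1 sx.
have cx : Num.conj x = x by rewrite (spectrum_oo_real sx) conj_rc.
have [d [M [d0 M0 dM]]] := resolvent_lipschitz rx.
apply: cvg_lim; first exact: norm_hausdorff.
move=> U /nbhs_CC[e e0 eU]; rewrite /fmap /= /dnbhs /within /=; apply/nbhs_CC.
set n := nrm (Res x mu).
have K0 : 0 < M * n ^+ 2 + 1 by rewrite ltr_wpDl // mulr_ge0 ?sqr_ge0 // ltW.
exists (Num.min d (e / (M * n ^+ 2 + 1))); first by rewrite lt_min d0 divr_gt0.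
move=> h; rewrite subr0 lt_min => /andP[hd he] h0; apply: eU.
have mh : modulus (Num.conj (h + x) - x) = modulus h.
  by rewrite -[X in _ - X]cx -rmorphB modulus_conj addrK.
have [|rw lip] := dM (Num.conj (h + x)) mu; first by rewrite mh.
have rw' : resolvent_set A (h + x) by rewrite -[h + x]conjCK; exact: resolvent_set_conj.
have -> : h^-1 *: (F (h + x) - F x) = << Res (Num.conj (h + x)) mu, Res x mu >>.
  rewrite borelB // addrK; exact: mulKf.
rewrite -(in_self hilbertH) -inNl -inDl.
rewrite (le_lt_trans (CauchySchwarz hilbertH _ _)) //.
rewrite mh -/n in lip; have n0 : 0 <= n := nrm_ge0 _.
have := ler_wpM2r n0 lip; rewrite -/n => h1; apply: (le_lt_trans h1).
move: he; rewrite ltr_pdivlMr //; have := modulus_ge0 h; lra.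
Qed.

Lemma eigenvectors_orthogonal (x y : spectrum Aoo) : x != y ->
  << Res (\val x) mu, Res (\val y) mu >> = 0.
Proof.
move=> xy; have sx := set_mem (valP x); have sy := set_mem (valP y).
have [rx Fx] := (spectrum_oo _).1 sx; have [ry Fy] := (spectrum_oo _).1 sy.
have := borelB rx ry; rewrite Fx Fy subr0 (spectrum_oo_real sx) conj_rc => /esym/eqP.
rewrite mulf_eq0 subr_eq0 => /orP[/eqP e|/eqP //].
by case/eqP: xy; apply: val_inj; rewrite -e -spectrum_oo_real.
Qed.

Lemma in_mu_eigenvector x : spectrum Aoo x -> << mu, Res x mu >> = 0.
Proof. by case/spectrum_oo. Qed.

Lemma in_eigenvector_mu x : spectrum Aoo x -> << Res x mu, mu >> = 0.
Proof. by move=> sx; rewrite inC in_mu_eigenvector ?conjC0. Qed.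

(** * The vectors xi(z) *)

(* xi z is the only vector normalized at z *)
Definition normalized z p : Prop :=
  << mu, p >> = 1 /\ exists c : CC R, A (p, Num.conj z *: p + c *: mu).

(* p - q is the resolvent of A_oo at conj z applied to (conj z - conj w) q, so
   the points of Sp(A) play no special role. *)
Lemma normalized_dist z w p q (M : R) : normalized z p -> normalized w q ->
  bounded_at Aoo (Num.conj z) M -> nrm (p - q) <= M * (modulus (z - w) * nrm q).
Proof.
move=> [p1 [c Ap]] [q1 [c' Aq]] bd.
rewrite -modulus_conj -nrmZ; apply: bd; split=> /=.
  by rewrite inDr inNr p1 q1 subrr.
exists (c' - c); have := relB linear_A Ap Aq; congr (A (_, _)).
by apply: (in_ext hilbertH) => ?; rewrite !ipE rmorphB; ring.
Qed.

Lemma normalized_xi_regular z : resolvent_set A (Num.conj z) -> F (Num.conj z) != 0 ->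
  normalized z (xi_regular ip A mu z).
Proof.
move=> rz Fz; split; first by rewrite inZr mulVf.
exists (F (Num.conj z))^-1; rewrite /xi_regular.
have := relZ linear_A (F (Num.conj z))^-1 (resolventP mu rz).
by congr (A (_, _)); vec.
Qed.

Lemma borel_neq0 z : resolvent_set A z -> resolvent_set Aoo z -> F z != 0.
Proof. by move=> rz roo; apply/eqP => Fz; exact: (spectrum_oo z).2 (conj rz Fz) roo. Qed.

(** The bound is taken at [Num.conj w], where [normalized_dist] needs it, and is uniform in w. *)
Lemma resolvent_oo_near z : resolvent_set Aoo z -> exists d M : R, [/\ 0 < d, 0 < M &
  forall w, modulus (w - z) < d ->
    resolvent_set Aoo w /\ bounded_at Aoo (Num.conj w) M].
Proof.
move=> /resolvent_oo_conj rz.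
have [d [M [d0 M0 dM]]] := resolvent_open hilbertH pure_point_oo rz.
exists d, M; split=> // w wd; have [|rw bw] := dM (Num.conj w).
  by rewrite -rmorphB modulus_conj.
by split=> //; rewrite -[w]conjCK; exact: resolvent_oo_conj.
Qed.

Lemma normalized_xi z : resolvent_set Aoo z -> normalized z (xi ip A mu z).
Proof.
move=> roo; rewrite /xi; case: ifPn => [/set_mem sz|/negP sz]; last first.
  have rz : resolvent_set A z by apply: contrapT => sz'; exact/sz/mem_set.
  apply: normalized_xi_regular; first exact: resolvent_set_conj.
  by apply: borel_neq0; [exact: resolvent_set_conj | exact: resolvent_oo_conj].
have zr := spectrum_real hilbertH symmetric_A pure_point_A sz.
have [[_ [V /nbhs_CC[d d0 dV] VA]] _] := discreteA sz.
have [e e0 Ae] := pure_point_A sz.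
have mue := cyclic_eigenvector e0 Ae.
(* At a pole of F the limit defining xi is the eigenvector of A scaled to <mu, p> = 1; p is
   normalized at z with c = 0, so [normalized_dist] proves the convergence. *)
pose p := (<< mu, e >>)^-1 *: e.
have np : normalized z p.
  split; first by rewrite inZr mulVf.
  exists 0; rewrite scale0r addr0 zr conj_rc -zr.
  by have := relZ linear_A (<< mu, e >>)^-1 Ae; rewrite scalerA mulrC -scalerA.
suff -> : lim (xi_regular ip A mu w @[w --> z^']) = p by [].
have [d' [M [d'0 M0 dM]]] := resolvent_oo_near roo.
apply: cvg_lim; first exact: norm_hausdorff.
move=> U /nbhs_H[eps eps0 eU]; rewrite /fmap /= /dnbhs /within /=; apply/nbhs_CC.
pose K := M * nrm p + 1.
have K0 : 0 < K by rewrite ltr_wpDl // mulr_ge0 ?nrm_ge0 // ltW.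
exists (Num.min (Num.min d d') (eps / K)); first by rewrite !lt_min d0 d'0 divr_gt0.
move=> w; rewrite !lt_min => /andP[/andP[wd wd'] we] wz; apply: eU.
have rw : resolvent_set A w.
  apply: contrapT => sw; have : (V `&` spectrum A) w by split => //; exact: dV.
  by rewrite VA => /eqP; apply/negP.
have [roow bw] := dM w wd'.
have nw : normalized w (xi_regular ip A mu w).
  apply: normalized_xi_regular; first exact: resolvent_set_conj.
  by apply: borel_neq0; [exact: resolvent_set_conj | exact: resolvent_oo_conj].
have := normalized_dist nw np bw; move/le_lt_trans; apply.
move: we; rewrite ltr_pdivlMr // /K; have := modulus_ge0 (w - z); lra.
Qed.

Lemma xi_locally_bounded z : resolvent_set Aoo z -> exists d C : R, [/\ 0 < d, 0 < C &
  forall w, modulus (w - z) < d -> resolvent_set Aoo w -> nrm (xi ip A mu w) <= C].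
Proof.
move=> rz; have [d [M [d0 M0 dM]]] := resolvent_oo_near rz.
set n := nrm (xi ip A mu z); have n0 : 0 <= n := nrm_ge0 _.
have C0 : 0 < M * (d * n) + n + 1.
  by rewrite ltr_wpDl // addr_ge0 // mulr_ge0 ?(ltW M0) // mulr_ge0 // ltW.
exists d, (M * (d * n) + n + 1); split=> // w wd rw.
have [_ bw] := dM w wd.
have h1 := normalized_dist (normalized_xi rw) (normalized_xi rz) bw.
rewrite -[xi ip A mu w](subrK (xi ip A mu z)) (le_trans (nrmD _ _)) //.
have h2 : M * (modulus (w - z) * n) <= M * (d * n).
  by rewrite ler_pM2l // ler_wpM2r // ltW.
rewrite -/n in h1 *; lra.
Qed.

Lemma in_xi_mu z : resolvent_set Aoo z -> << xi ip A mu z, mu >> = 1.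
Proof. by move=> /normalized_xi[m _]; rewrite inC m conjC1. Qed.

(** Pair A xi = conj z xi + c mu with A eta = mu + x eta, for eta = [Res x mu], by symmetry of A:
    <mu, eta> = 0 and <xi, mu> = 1 leave (z - x) <xi, eta> = 1. *)
Lemma in_xi_eigenvector z x : resolvent_set Aoo z -> spectrum Aoo x ->
  << xi ip A mu z, Res x mu >> = (z - x)^-1.
Proof.
move=> rz sx; have [_ [c Ap]] := normalized_xi rz.
have [rx _] := (spectrum_oo _).1 sx.
have := symmetric_A Ap (resolventP mu rx).
rewrite !ipE in_xi_mu // in_mu_eigenvector // mulr0 addr0 conjCK => h.
have zx : (z - x) * << xi ip A mu z, Res x mu >> = 1.
  by rewrite mulrBl -h addrK.
have zx0 : z - x != 0.
  apply: contraTneq isT => e; move: zx; rewrite e mul0r => /eqP.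
  by rewrite eq_sym oner_eq0.
by rewrite -[LHS]mul1r -(mulVf zx0) -mulrA zx mulr1.
Qed.

(** * Eigenvector expansions and partial fractions *)

Let eta (x : spectrum Aoo) : H := Res (\val x) mu.

Lemma weighted_square_summableP (a : spectrum Aoo -> CC R) :
  weighted_square_summable a <->
  exists M : R, forall B : {fset spectrum Aoo}, \sum_(x <- B) weight eta a x <= M.
Proof.
apply: (iff_trans _ (esum_lt_pinfty (weight_ge0 eta a))).
rewrite /weighted_square_summable.
suff -> : (fun x : spectrum Aoo =>
    (complex.Re (`|a x| ^+ 2 * derive1 F (\val x)))%:E) =
    (fun x : spectrum Aoo => (weight eta a x)%:E) by [].
apply/funext => x; rewrite derive1_borel; last exact: set_mem (valP x).
by rewrite modulusE -rcX -rcM Re_rc.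
Qed.

Lemma partial_fractionsE (a : spectrum Aoo -> CC R) B (z : ~` spectrum Aoo) :
  partial_fractions a B z =
  << xi ip A mu (\val z), summability.partial_sum (fun i => a i *: eta i) B >>.
Proof.
rewrite /partial_fractions !partial_sumE in_sumr; apply: eq_bigr => x _.
have rz : resolvent_set Aoo (\val z) by apply: contrapT; exact: (set_mem (valP z)).
by rewrite inZr in_xi_eigenvector //; exact: set_mem (valP x).
Qed.

Lemma orthogonal_series (a : spectrum Aoo -> CC R) : weighted_square_summable a ->
  exists psi, forall e : R, 0 < e -> summability.totally
    [set B | nrm (summability.partial_sum (fun i => a i *: eta i) B - psi) < e].
Proof.
move=> /weighted_square_summableP[M aM].
exact: (orthogonal_series_cvg hilbertH eigenvectors_orthogonal aM).
Qed.

Section Sum.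
Variables (a : spectrum Aoo -> CC R) (psi : H).
Hypothesis cvg_psi : forall e : R, 0 < e -> summability.totally
    [set B | nrm (summability.partial_sum (fun i => a i *: eta i) B - psi) < e].

Lemma in_sum v : forall e : R, 0 < e -> summability.totally
  [set B | modulus (<< v, summability.partial_sum (fun i => a i *: eta i) B >> -
                    << v, psi >>) < e].
Proof.
move=> e e0; have K0 : 0 < nrm v + 1 by rewrite ltr_wpDl ?nrm_ge0.
apply: filterS (cvg_psi (divr_gt0 e0 K0)) => B /=.
rewrite ltr_pdivlMr // => h; rewrite -inNr -inDr.
rewrite (le_lt_trans (CauchySchwarz hilbertH _ _)) // (le_lt_trans _ h) //.
by rewrite mulrC ler_wpM2l ?nrm_ge0 // lerDl.
Qed.

Lemma partial_fraction_seriesE (z : ~` spectrum Aoo) :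
  partial_fraction_series a z = << xi ip A mu (\val z), psi >>.
Proof.
rewrite /partial_fraction_series /summability.sum.
apply: cvg_lim; first exact: norm_hausdorff.
move=> U /nbhs_CC[e e0 eU]; apply: filterS (in_sum (xi ip A mu (\val z)) e0) => B /= h.
by apply: eU; move: h; rewrite -partial_fractionsE.
Qed.

Lemma in_mu_sum : << mu, psi >> = 0.
Proof.
apply/eqP; rewrite -modulus_eq0 eq_le modulus_ge0 andbT.
apply/ler_addgt0Pr => e e0; have [B /=] := filter_ex (in_sum mu e0).
rewrite partial_sumE in_sumr big1 ?sub0r ?modulusN ?add0r; first exact: ltW.
by move=> x _; rewrite inZr in_mu_eigenvector ?mulr0 //; exact: set_mem (valP x).
Qed.

Lemma in_eigenvector_sum (x : spectrum Aoo) :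
  << eta x, psi >> = a x * rc (nrm (eta x) ^+ 2).
Proof.
apply/eqP; rewrite eq_sym -subr_eq0 -modulus_eq0 eq_le modulus_ge0 andbT.
apply/ler_addgt0Pr => e e0; rewrite add0r.
(* For finite sets containing x, the inner product of eta x with the partial sum is already the
   claimed value. *)
have xin : summability.totally [set B : {fset spectrum Aoo} | x \in B].
  by exists [fset x]%fset => // B /=; rewrite fsub1set.
have [B [/= h xB]] := filter_ex (filterI (in_sum (eta x) e0) xin).
apply: ltW; move: h; rewrite partial_sumE in_sumr (bigD1_seq x) ?fset_uniq //=.
rewrite big1 ?addr0 => [|y yx]; first by rewrite inZr in_self.
by rewrite inZr eigenvectors_orthogonal ?mulr0 // eq_sym.
Qed.

End Sum.

Lemma Phi_sum (c : CC R) (a : spectrum Aoo -> CC R) (psi : H) :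
  (forall e : R, 0 < e -> summability.totally
    [set B | nrm (summability.partial_sum (fun i => a i *: eta i) B - psi) < e]) ->
  @Phi R H ip A mu (c *: mu + psi) =
  (fun z : ~` spectrum Aoo => c + partial_fraction_series a z).
Proof.
move=> cvg_psi; apply/funext => z.
have rz : resolvent_set Aoo (\val z) by apply: contrapT; exact: (set_mem (valP z)).
by rewrite (partial_fraction_seriesE cvg_psi) /Phi inDr inZr in_xi_mu // mulr1.
Qed.

(** Take c = <mu, phi> and the Fourier coefficients of phi, summable by Bessel; what remains of phi
    is orthogonal to mu and to all eigenvectors, hence 0. *)
Lemma vector_expansion phi : exists (c : CC R) (a : spectrum Aoo -> CC R) (psi : H),
  [/\ weighted_square_summable a,
      (forall e : R, 0 < e -> summability.totally
        [set B | nrm (summability.partial_sum (fun i => a i *: eta i) B - psi) < e]) &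
      phi = c *: mu + psi].
Proof.
pose a (x : spectrum Aoo) := << eta x, phi >> / rc (nrm (eta x) ^+ 2).
have aE (x : spectrum Aoo) : << eta x, phi >> = a x * rc (nrm (eta x) ^+ 2).
  rewrite divfK // -(@rc0 R) (inj_eq (@rc_inj R)) sqrf_eq0 nrm_eq0.
  by apply: resolvent_mu_neq0; case: ((spectrum_oo _).1 (set_mem (valP x))).
have sa : weighted_square_summable a.
  apply/weighted_square_summableP; exists (nrm phi ^+ 2) => B.
  exact: (Bessel hilbertH eigenvectors_orthogonal).
have [psi cvg_psi] := orthogonal_series sa.
exists << mu, phi >>, a, psi; split=> //; apply/eqP; rewrite -subr_eq0; apply/eqP.
apply: orthogonal_to_mu_and_eigenvectors => [|x sx].
  rewrite !ipE (in_mu_sum cvg_psi) (in_self hilbertH) nrm_mu expr1n mulr1 addr0.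
  by rewrite subrr.
have := in_eigenvector_sum cvg_psi (SigSub (mem_set sx)); rewrite -aE /eta /= => e.
by rewrite !ipE e in_eigenvector_mu // mulr0 add0r subrr.
Qed.

Lemma partial_fractions_cvg (a : spectrum Aoo -> CC R) :
  weighted_square_summable a ->
  {family compact,
     partial_fractions a @ summability.totally --> partial_fraction_series a}.
Proof.
move=> /orthogonal_series[psi cvg_psi]; apply/fam_cvgP => K cK.
move=> U /uniform_nbhs[E [entE EU]].
move: entE; rewrite -entourage_ballE => -[r /= r0 rE].
have r0' : 0 < complex.Re r by rewrite -ltr_rc rc0 -ge0_rcE // ltW.
pose near_sum (B : {fset spectrum Aoo}) (z : ~` spectrum Aoo) :=
  ball (partial_fraction_series a z) r (partial_fractions a B z).
(* The error at z' is at most |xi z'| times the norm of the remainder vector, which does not depend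
   on z'. A local bound on xi gives uniformity near each point, and the near-covering form of
   compactness spreads it over K. *)
have cover : forall z : ~` spectrum Aoo, K z ->
    \forall z' \near z & B \near summability.totally, near_sum B z'.
  move=> z Kz; have rz : resolvent_set Aoo (\val z).
    by apply: contrapT; exact: (set_mem (valP z)).
  have [d [C [d0 C0 bd]]] := xi_locally_bounded rz.
  exists ([set z' : ~` spectrum Aoo | modulus (\val z' - \val z) < d],
    [set B | nrm (summability.partial_sum (fun i => a i *: eta i) B - psi)
             < complex.Re r / C]); first split => /=.
  - apply: (@initial_continuous _ _ (\val : ~` spectrum Aoo -> CC R) z
      [set w | modulus (w - \val z) < d]).
    by apply/nbhs_CC; exists d.
  - by apply: cvg_psi; rewrite divr_gt0.
  move=> [z' B] /= [dz' dB]; rewrite /near_sum -ball_normE /= distrC modulusE.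
  have rz' : resolvent_set Aoo (\val z').
    by apply: contrapT; exact: (set_mem (valP z')).
  rewrite (ge0_rcE (ltW r0)) ltr_rc (partial_fraction_seriesE cvg_psi).
  rewrite partial_fractionsE -inNr -inDr.
  rewrite (le_lt_trans (CauchySchwarz hilbertH _ _)) //.
  move: dB; rewrite ltr_pdivlMr // mulrC; apply: le_lt_trans.
  by rewrite ler_wpM2r ?nrm_ge0 ?bd.
have := iffLR (compact_near_coveringP K) cK _ _ near_sum summability.totally_filter cover.
apply: filterS => B KB; apply: EU => z Kz; apply: rE; exact: KB.
Qed.

End RankOnePerturbation.

Theorem proposition2 (R : realType) (H : completeNormedModType (CC R))
    (ip : {dot H for @Num.conj (CC R)}) (A : set (H * H)) (mu : H)
    (hilbertH : hilbert ip)
    (separableH : separable H)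
    (selfadjointA : self_adjoint_operator ip A)
    (discreteA : simple_discrete_spectrum A)
    (cyclic_mu : cyclic_vector A mu)
    (norm_mu : `|mu| = 1) :
  let Sp_oo := spectrum (infinite_coupling ip A mu) in
  Hhat ip A mu =
    [set f | exists (c : CC R) (a : Sp_oo -> CC R),
       weighted_square_summable a /\
       f = (fun z => c + partial_fraction_series a z)]
  /\
  (forall a : Sp_oo -> CC R, weighted_square_summable a ->
     {family compact,
       partial_fractions a @ summability.totally --> partial_fraction_series a}).
Proof.
move=> Sp_oo; split; last first.
  move=> a; exact: partial_fractions_cvg.
apply/seteqP; split=> [_ [phi _ <-]|_ [c [a [sa ->]]]].
  have [c [a [psi [sa cvg_psi ->]]]] := vector_expansion hilbertH selfadjointA
    discreteA cyclic_mu norm_mu phi.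
  by exists c, a; split=> //; apply: Phi_sum cvg_psi.
have [psi cvg_psi] := orthogonal_series hilbertH selfadjointA discreteA cyclic_mu
  norm_mu sa.
by exists (c *: mu + psi) => //; apply: Phi_sum cvg_psi.
Qed.
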